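(* Let $k$ be an algebraically closed field, let $n\ge 1$, and let $A=kC_n/I_n$. Then the indecomposable objects of the homotopy category $K(\operatorname{Inj}A)$ are, up to shifts and isomorphism, exactly the truncations $\sigma_{\le m}\sigma_{\ge l}I^{\bullet}$ with $l\in\mathbb{Z}\cup\{-\infty\}$, $m\in\mathbb{Z}\cup\{+\infty\}$, $l\le m$, where $I^{\bullet}$ is the periodic complex $$\cdots\to I_n\xrightarrow{d_n}I_{n-1}\xrightarrow{d_{n-1}}I_{n-2}\to\cdots\to I_1\xrightarrow{d_1}I_n\xrightarrow{d_n}\cdots$$ with differential $d_j:I_j\to I_{j-1}$ the composite $I_j\to I_j/\operatorname{soc}I_j\cong\operatorname{rad}I_{j-1}\hookrightarrow I_{j-1}$. Moreover, all indecomposable objects of $K(\operatorname{Inj}A)$ are endofinite.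
   Context: $C_n$ is the cyclic quiver with vertices $1,\dots,n$ and one arrow $i\to i+1$ for each $i$ (indices modulo $n$; for $n=1$ a single loop), all arrows being denoted $\alpha$; $I_n$, when it denotes the ideal of relations, is the ideal of $kC_n$ generated by all paths $\alpha^2$ of length two. $A$-modules are identified with representations of $C_n$ satisfying these relations (arbitrary, not necessarily finite dimensional). In the complex, $I_j$ ($1\le j\le n$) denotes the indecomposable injective $A$-module with simple socle at vertex $j$, with indices modulo $n$ (so $I_0=I_n$). $I^{\bullet}$ is a cochain complex with $I_1$ in degree $0$. $K(\operatorname{Inj}A)$ is the homotopy category of (unbounded) cochain complexes of arbitrary injective $A$-modules; it is a compactly generated triangulated category. $\sigma_{\le m}$ and $\sigma_{\ge l}$ are the brutal truncations: $\sigma_{\le m}\sigma_{\ge l}X$ has the terms and differentials of $X$ in degrees $i$ with $l\le i\le m$ and zero in all other degrees (no truncation when $l=-\infty$, resp. $m=+\infty$). An object $E$ of a compactly generated triangulated category $\mathcal{T}$ is endofinite if for every compact object $X$ of $\mathcal{T}$ the $\operatorname{End}_{\mathcal{T}}(E)$-module $\operatorname{Hom}_{\mathcal{T}}(X,E)$ has finite length. *)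

(* Defs.v *)
From HB Require Import structures.
From mathcomp Require Import all_boot all_order all_algebra.
From mathcomp Require Import all_classical constructive_ereal.

Set Implicit Arguments.
Unset Strict Implicit.
Unset Printing Implicit Defensive.

Import Order.TTheory GRing.Theory Num.Theory.

Local Open Scope classical_set_scope.
Local Open Scope ring_scope.

(* Preadditive with a zero object; no direct sums are required. *)

Record addcat := AddCat {
  obj :> Type;
  hom : obj -> obj -> zmodType;
  idm : forall X, hom X X;
  comp : forall X Y Z, hom Y Z -> hom X Y -> hom X Z;
  comp_assoc : forall X Y Z T (h : hom Z T) (g : hom Y Z) (f : hom X Y),
    comp h (comp g f) = comp (comp h g) f;
  comp_idl : forall X Y (f : hom X Y), comp (idm Y) f = f;
  comp_idr : forall X Y (f : hom X Y), comp f (idm X) = f;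
  comp_addl : forall X Y Z (g g' : hom Y Z) (f : hom X Y),
    comp (g + g') f = comp g f + comp g' f;
  comp_addr : forall X Y Z (g : hom Y Z) (f f' : hom X Y),
    comp g (f + f') = comp g f + comp g f';
  zob : obj;
  idm_zob : idm zob = 0 }.

Arguments hom {a} _ _.
Arguments idm {a} _.
Arguments comp {a X Y Z} _ _.

Declare Scope addcat_scope.
Delimit Scope addcat_scope with addcat.
Notation "g '\oc' f" := (comp g f) (at level 40, left associativity)
  : addcat_scope.
Local Open Scope addcat_scope.

Section AddCatTheory.
Variable C : addcat.
Implicit Types X Y Z : C.

Lemma comp0m X Y Z (f : hom X Y) : (0 : hom Y Z) \oc f = 0.
Proof. by apply: (addrI (0 \oc f)); rewrite -comp_addl !addr0. Qed.

Lemma compm0 X Y Z (g : hom Y Z) : g \oc (0 : hom X Y) = 0.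
Proof. by apply: (addrI (g \oc 0)); rewrite -comp_addr !addr0. Qed.

Lemma compNm X Y Z (g : hom Y Z) (f : hom X Y) : (- g) \oc f = - (g \oc f).
Proof. by apply: (addrI (g \oc f)); rewrite -comp_addl !subrr comp0m. Qed.

Lemma compmN X Y Z (g : hom Y Z) (f : hom X Y) : g \oc (- f) = - (g \oc f).
Proof. by apply: (addrI (g \oc f)); rewrite -comp_addr !subrr compm0. Qed.

Definition is_zero X := idm X = 0.

Definition isomorphic X Y :=
  exists (f : hom X Y) (g : hom Y X), g \oc f = idm X /\ f \oc g = idm Y.

Definition is_direct_sum X Y Z :=
  exists (i1 : hom Y X) (i2 : hom Z X) (p1 : hom X Y) (p2 : hom X Z),
    [/\ p1 \oc i1 = idm Y, p2 \oc i2 = idm Z, p1 \oc i2 = 0, p2 \oc i1 = 0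
      & i1 \oc p1 + i2 \oc p2 = idm X].

Definition indecomposable X :=
  ~ is_zero X /\
  forall Y Z, is_direct_sum X Y Z -> is_zero Y \/ is_zero Z.

Definition is_coproduct (J : choiceType) (Y : J -> C) (S : C)
    (iota : forall j, hom (Y j) S) :=
  forall T (f : forall j, hom (Y j) T),
    exists! u : hom S T, forall j, u \oc iota j = f j.

(* hom X - preserves coproducts: the canonical map from the direct sum of the *)
(* hom X (Y j), i.e. the families with finite support, to hom X S is          *)
(* bijective.                                                                 *)
Definition compact X :=
  forall (J : choiceType) (Y : J -> C) (S : C) (iota : forall j, hom (Y j) S),
    is_coproduct iota ->
    forall f : hom X S,
      exists! g : forall j, hom X (Y j),
        finite_set [set j | g j <> 0] /\
        f = \sum_(j \in [set: J]) (iota j \oc g j).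

End AddCatTheory.

(* hom X E as a left module over the endomorphism ring of E. *)

Definition endo (C : addcat) (E : C) : Type := hom E E.
Definition endo_hom (C : addcat) (X E : C) : Type := hom X E.

Section EndoModule.
Variables (C : addcat) (E : C).

HB.instance Definition _ := GRing.Zmodule.copy (endo E) (hom E E).

HB.instance Definition _ := GRing.Zmodule_isPzRing.Build (endo E)
  (@comp_assoc C E E E E) (@comp_idl C E E) (@comp_idr C E E)
  (@comp_addl C E E E) (@comp_addr C E E E).

Variable X : C.

HB.instance Definition _ := GRing.Zmodule.copy (endo_hom X E) (hom X E).

Definition endo_scale (a : endo E) (f : endo_hom X E) : endo_hom X E := a \oc f.

Fact endo_scaleA a b f : endo_scale a (endo_scale b f) = endo_scale (a * b) f.
Proof. exact: comp_assoc. Qed.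

Fact endo_scale1 : left_id 1 endo_scale.
Proof. exact: comp_idl. Qed.

Fact endo_scaleDr : right_distributive endo_scale +%R.
Proof. exact: comp_addr. Qed.

Fact endo_scaleDl f : {morph endo_scale^~ f : a b / a + b}.
Proof. by move=> a b; exact: comp_addl. Qed.

HB.instance Definition _ := GRing.Zmodule_isLmodule.Build (endo E) (endo_hom X E)
  endo_scaleA endo_scale1 endo_scaleDr endo_scaleDl.

End EndoModule.

(* Existence of a composition series of length r. *)
Definition finite_length (R : pzRingType) (V : lmodType R) :=
  exists (r : nat) (M : nat -> {pred V}),
    [/\ forall i, GRing.submod_closed (M i), M 0%N =i pred1 0, M r =i predT
      & forall i, (i < r)%N ->
          [/\ {subset M i <= M i.+1}, ~ {subset M i.+1 <= M i}
            & forall N : {pred V}, GRing.submod_closed N ->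
                {subset M i <= N} -> {subset N <= M i.+1} ->
                N =i M i \/ N =i M i.+1]].

Definition endofinite (C : addcat) (E : C) :=
  forall X : C, compact X -> finite_length (endo_hom X E : lmodType (endo E)).

Section FullSubcategory.
Variables (C : addcat) (P : C -> Prop) (P0 : P (zob C)).

Definition full_subcat : addcat :=
  @AddCat {X : C | P X} (fun X Y => hom (sval X) (sval Y))
    (fun X => idm (sval X)) (fun X Y Z g f => g \oc f)
    (fun X Y Z T => @comp_assoc C _ _ _ _) (fun X Y => @comp_idl C _ _)
    (fun X Y => @comp_idr C _ _) (fun X Y Z => @comp_addl C _ _ _)
    (fun X Y Z => @comp_addr C _ _ _) (exist _ (zob C) P0) (idm_zob C).

End FullSubcategory.

(* Cochain complexes. To avoid casts along equations between degrees, the     *)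
(* differential is given by all its components diff i j, which vanish for     *)
(* j != i + 1.                                                                *)

Record complex (C : addcat) := Complex {
  term :> int -> C;
  diff : forall i j, hom (term i) (term j);
  diff_degree : forall i j, j != i + 1 -> diff i j = 0;
  diff_diff : forall i j l, diff j l \oc diff i j = 0 }.

Arguments diff {C} _ _ _.

Record chain_map (C : addcat) (X Y : complex C) := ChainMap {
  chm :> forall i, hom (X i) (Y i);
  chmP : forall i j, chm j \oc diff X i j = diff Y i j \oc chm i }.

HB.instance Definition _ (C : addcat) (X Y : complex C) :=
  gen_eqMixin (chain_map X Y).
HB.instance Definition _ (C : addcat) (X Y : complex C) :=
  gen_choiceMixin (chain_map X Y).

Section ChainMaps.
Variable C : addcat.
Implicit Types X Y Z : complex C.

Lemma chain_map_ext X Y (f g : chain_map X Y) : (forall i, f i = g i) -> f = g.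
Proof.
case: f g => [f fP] [g gP] /= efg; have {}efg : f = g by exact: functional_extensionality_dep.
by move: gP; rewrite -efg => gP; congr ChainMap; exact: Prop_irrelevance.
Qed.

Section ZmodStructure.
Variables X Y : complex C.
Implicit Types f g : chain_map X Y.

Fact chain_zeroP i j : (0 : hom (X j) (Y j)) \oc diff X i j = diff Y i j \oc 0.
Proof. by rewrite comp0m compm0. Qed.
Definition chain_zero : chain_map X Y := @ChainMap C X Y (fun=> 0) chain_zeroP.

Fact chain_oppP f i j : (- f j) \oc diff X i j = diff Y i j \oc - f i.
Proof. by rewrite compNm compmN chmP. Qed.
Definition chain_opp f : chain_map X Y := ChainMap (chain_oppP f).

Fact chain_addP f g i j : (f j + g j) \oc diff X i j = diff Y i j \oc (f i + g i).
Proof. by rewrite comp_addl comp_addr !chmP. Qed.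
Definition chain_add f g : chain_map X Y := ChainMap (chain_addP f g).

Fact chain_addA : associative chain_add.
Proof. by move=> f g h; apply: chain_map_ext => i; exact: addrA. Qed.
Fact chain_addC : commutative chain_add.
Proof. by move=> f g; apply: chain_map_ext => i; exact: addrC. Qed.
Fact chain_add0 : left_id chain_zero chain_add.
Proof. by move=> f; apply: chain_map_ext => i; exact: add0r. Qed.
Fact chain_addN : left_inverse chain_zero chain_opp chain_add.
Proof. by move=> f; apply: chain_map_ext => i; exact: addNr. Qed.

HB.instance Definition _ := GRing.isZmodule.Build (chain_map X Y)
  chain_addA chain_addC chain_add0 chain_addN.

Lemma chain0E i : (0 : chain_map X Y) i = 0. Proof. by []. Qed.
Lemma chainNE f i : (- f) i = - f i. Proof. by []. Qed.
Lemma chainDE f g i : (f + g) i = f i + g i. Proof. by []. Qed.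

(* Only the components h i (i - 1) of h matter. *)
Definition null_homotopic f :=
  exists h : forall i j, hom (X i) (Y j), forall i,
    f i = diff Y (i - 1) i \oc h i (i - 1) + h (i + 1) i \oc diff X i (i + 1).

Definition null_homotopicb : {pred chain_map X Y} :=
  [pred f | `[< null_homotopic f >]].

Fact null_homotopic_zmod : zmod_closed null_homotopicb.
Proof.
split=> [|f g]; rewrite !inE.
  by exists (fun _ _ => 0) => i; rewrite compm0 comp0m addr0.
move=> [h hP] [h' hP'].
exists (fun i j => h i j - h' i j) => i.
rewrite chainDE chainNE hP hP' comp_addl comp_addr compNm compmN.
by rewrite opprD addrACA.
Qed.

HB.instance Definition _ :=
  GRing.isZmodClosed.Build (chain_map X Y) null_homotopicb null_homotopic_zmod.

Definition khom : zmodType := Quotient.quot null_homotopicb.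

End ZmodStructure.

Fact chain_idP X i j : idm (X j) \oc diff X i j = diff X i j \oc idm (X i).
Proof. by rewrite comp_idl comp_idr. Qed.
Definition chain_id X : chain_map X X := ChainMap (@chain_idP X).

Fact chain_compP X Y Z (g : chain_map Y Z) (f : chain_map X Y) i j :
  (g j \oc f j) \oc diff X i j = diff Z i j \oc (g i \oc f i).
Proof. by rewrite -comp_assoc chmP comp_assoc chmP -comp_assoc. Qed.
Definition chain_comp X Y Z (g : chain_map Y Z) (f : chain_map X Y) :
  chain_map X Z := ChainMap (chain_compP g f).

End ChainMaps.

Section HomotopyCategory.
Variable C : addcat.
Implicit Types X Y Z : complex C.
Local Open Scope quotient_scope.

Definition kclass X Y (f : chain_map X Y) : khom X Y :=
  \pi_(Quotient.quot (null_homotopicb (X:=X) (Y:=Y))) f.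

Definition krepr X Y (f : khom X Y) : chain_map X Y := repr f.

Lemma kreprK X Y : cancel (@krepr X Y) (@kclass X Y).
Proof. by move=> f; rewrite /kclass /krepr reprK. Qed.

Lemma kclassP X Y (f g : chain_map X Y) :
  kclass f = kclass g <-> null_homotopic (f - g).
Proof.
rewrite /kclass; split.
  by move/eqP; rewrite -Quotient.idealrBE inE.
by move=> fg; apply/eqP; rewrite -Quotient.idealrBE inE.
Qed.

Lemma kclassD X Y (f g : chain_map X Y) : kclass (f + g) = kclass f + kclass g.
Proof. exact: raddfD. Qed.

Lemma kclass0 X Y : kclass (0 : chain_map X Y) = 0.
Proof. exact: raddf0. Qed.

Definition kid X : khom X X := kclass (chain_id X).
Definition kcomp X Y Z (g : khom Y Z) (f : khom X Y) : khom X Z :=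
  kclass (chain_comp (krepr g) (krepr f)).

Lemma kcompE X Y Z (g : chain_map Y Z) (f : chain_map X Y) :
  kcomp (kclass g) (kclass f) = kclass (chain_comp g f).
Proof.
have /kclassP[h hP] : kclass (krepr (kclass g)) = kclass g by exact: kreprK.
have /kclassP[h' hP'] : kclass (krepr (kclass f)) = kclass f by exact: kreprK.
set g1 := krepr _ in hP *; set f1 := krepr _ in hP' *.
apply/kclassP; exists (fun i j => h i j \oc f1 i + g j \oc h' i j) => i.
have -> : (chain_comp g1 f1 - chain_comp g f) i =
    (g1 - g) i \oc f1 i + g i \oc (f1 - f) i.
  rewrite !chainDE !chainNE /= !comp_addl !comp_addr compNm compmN addrA.
  by rewrite addrNK.
rewrite hP hP' !comp_addl !comp_addr !comp_assoc -(chmP g).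
by rewrite -!(comp_assoc (h _ _)) (chmP f1) addrACA.
Qed.

Fact kcompA X Y Z T (h : khom Z T) (g : khom Y Z) (f : khom X Y) :
  kcomp h (kcomp g f) = kcomp (kcomp h g) f.
Proof.
rewrite -[h]kreprK -[g]kreprK -[f]kreprK !kcompE; congr kclass.
by apply: chain_map_ext => i; exact: comp_assoc.
Qed.

Fact kcomp1m X Y (f : khom X Y) : kcomp (kid Y) f = f.
Proof.
rewrite -[f]kreprK kcompE; congr kclass.
by apply: chain_map_ext => i; exact: comp_idl.
Qed.

Fact kcompm1 X Y (f : khom X Y) : kcomp f (kid X) = f.
Proof.
rewrite -[f]kreprK kcompE; congr kclass.
by apply: chain_map_ext => i; exact: comp_idr.
Qed.

Fact kcompDl X Y Z (g g' : khom Y Z) (f : khom X Y) :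
  kcomp (g + g') f = kcomp g f + kcomp g' f.
Proof.
rewrite -[g]kreprK -[g']kreprK -[f]kreprK -kclassD !kcompE -kclassD.
by congr kclass; apply: chain_map_ext => i; exact: comp_addl.
Qed.

Fact kcompDr X Y Z (g : khom Y Z) (f f' : khom X Y) :
  kcomp g (f + f') = kcomp g f + kcomp g f'.
Proof.
rewrite -[g]kreprK -[f]kreprK -[f']kreprK -kclassD !kcompE -kclassD.
by congr kclass; apply: chain_map_ext => i; exact: comp_addr.
Qed.

Definition zero_complex : complex C :=
  @Complex C (fun=> zob C) (fun _ _ => 0) (fun _ _ _ => erefl)
    (fun _ _ _ => comp0m _ _).

Fact kid_zero : kid zero_complex = 0.
Proof.
rewrite -kclass0; congr kclass; apply: chain_map_ext => i; exact: idm_zob.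
Qed.

Definition homotopy_cat : addcat :=
  AddCat kcompA kcomp1m kcompm1 kcompDl kcompDr kid_zero.

End HomotopyCategory.

(* The shift X[p], with X[p]^i = X^(i + p) and differential (-1)^p d. *)

Section Shift.
Variables (C : addcat) (p : int) (X : complex C).

Definition shift_diff i j : hom (X (i + p)) (X (j + p)) :=
  if odd `|p|%N then - diff X (i + p) (j + p) else diff X (i + p) (j + p).

Fact shift_diff_degree i j : j != i + 1 -> shift_diff i j = 0.
Proof.
move=> ij; rewrite /shift_diff diff_degree ?oppr0 ?if_same //.
by rewrite addrAC (inj_eq (addIr p)).
Qed.

Fact shift_diff_diff i j l : shift_diff j l \oc shift_diff i j = 0.
Proof.
by rewrite /shift_diff; case: ifP => _; rewrite ?compNm ?compmN diff_diff ?oppr0.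
Qed.

Definition shift : complex C :=
  @Complex C (fun i => X (i + p)) shift_diff shift_diff_degree shift_diff_diff.

End Shift.

(* Brutal truncations; l = -oo or m = +oo means no truncation on that side. *)

Section Truncation.
Variables (C : addcat) (l m : \bar int) (X : complex C).

Definition in_range (i : int) : bool := (l <= i%:E)%E && (i%:E <= m)%E.

Definition if_obj (b : bool) (Y : C) : C := if b then Y else zob C.

Definition if_hom (b b' : bool) (Y Z : C) (f : hom Y Z) :
    hom (if_obj b Y) (if_obj b' Z) :=
  match b, b' return hom (if_obj b Y) (if_obj b' Z) with
  | true, true => f
  | _, _ => 0
  end.

Definition trunc_diff i j := if_hom (in_range i) (in_range j) (diff X i j).

Fact trunc_diff_degree i j : j != i + 1 -> trunc_diff i j = 0.
Proof.
move=> ij; rewrite /trunc_diff diff_degree //.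
by case: (in_range i); case: (in_range j).
Qed.

Fact trunc_diff_diff i j q : trunc_diff j q \oc trunc_diff i j = 0.
Proof.
rewrite /trunc_diff; case: (in_range i); case: (in_range j) => /=;
  rewrite ?compm0 //.
by case: (in_range q) => /=; rewrite ?comp0m ?diff_diff.
Qed.

Definition trunc : complex C :=
  @Complex C (fun i => if_obj (in_range i) (X i)) trunc_diff
    trunc_diff_degree trunc_diff_diff.

End Truncation.

(* Modules over k C_n / (alpha^2), as representations. The vertices are the   *)
(* residues modulo n, so that vertex n is the residue 0, and ordS is the      *)
(* cyclic successor.                                                          *)

Section Representations.
Variables (k : fieldType) (n : nat).

Record rep := Rep {
  space :> 'I_n -> lmodType k;
  arrow : forall v, space v -> space (ordS v);
  arrow_linear : forall v, linear (@arrow v);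
  arrow_arrow : forall v (x : space v), arrow (arrow x) = 0 }.

Arguments arrow _ {v} _.

HB.instance Definition _ (M : rep) v :=
  GRing.isLinear.Build k (M v) (M (ordS v)) *:%R (@arrow M v)
    (@arrow_linear M v).

Record rep_hom (M N : rep) := RepHom {
  rhom : forall v, M v -> N v;
  rhom_linear : forall v, linear (@rhom v);
  rhom_arrow : forall v (x : M v), rhom (arrow M x) = arrow N (rhom x) }.

Arguments rhom {M N} _ {v} _.

HB.instance Definition _ M N (f : rep_hom M N) v :=
  GRing.isLinear.Build k (M v) (N v) *:%R (@rhom M N f v)
    (@rhom_linear M N f v).

HB.instance Definition _ M N := gen_eqMixin (rep_hom M N).
HB.instance Definition _ M N := gen_choiceMixin (rep_hom M N).

Lemma rep_hom_ext M N (f g : rep_hom M N) :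
  (forall v (x : M v), rhom f x = rhom g x) -> f = g.
Proof.
case: f g => [f fl fP] [g gl gP] /= efg.
have {}efg : f = g.
  by apply: functional_extensionality_dep => v; apply: funext; exact: efg.
move: gl gP; rewrite -efg => gl gP.
by rewrite (Prop_irrelevance gl fl) (Prop_irrelevance gP fP).
Qed.

Section RepHomZmod.
Variables M N : rep.
Implicit Types f g : rep_hom M N.

Definition rep_zero : rep_hom M N.
Proof.
exists (fun v _ => 0) => [v a x y|v x]; first by rewrite scaler0 addr0.
by rewrite linear0.
Defined.

Definition rep_opp f : rep_hom M N.
Proof.
exists (fun v x => - rhom f x) => [v a x y|v x].
  by rewrite linearP opprD scalerN.
by rewrite rhom_arrow linearN.
Defined.

Definition rep_add f g : rep_hom M N.
Proof.
exists (fun v x => rhom f x + rhom g x) => [v a x y|v x].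
  by rewrite !linearP scalerDr addrACA.
by rewrite !rhom_arrow linearD.
Defined.

Fact rep_addA : associative rep_add.
Proof. by move=> f g h; apply: rep_hom_ext => v x; exact: addrA. Qed.
Fact rep_addC : commutative rep_add.
Proof. by move=> f g; apply: rep_hom_ext => v x; exact: addrC. Qed.
Fact rep_add0 : left_id rep_zero rep_add.
Proof. by move=> f; apply: rep_hom_ext => v x; exact: add0r. Qed.
Fact rep_addN : left_inverse rep_zero rep_opp rep_add.
Proof. by move=> f; apply: rep_hom_ext => v x; exact: addNr. Qed.

HB.instance Definition _ := GRing.isZmodule.Build (rep_hom M N)
  rep_addA rep_addC rep_add0 rep_addN.

End RepHomZmod.

Definition rep_id M : rep_hom M M :=
  @RepHom M M (fun v x => x) (fun _ _ _ _ => erefl) (fun _ _ => erefl).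

Definition rep_comp M N P (g : rep_hom N P) (f : rep_hom M N) : rep_hom M P.
Proof.
exists (fun v x => rhom g (rhom f x)) => [v a x y|v x]; first by rewrite !linearP.
by rewrite !rhom_arrow.
Defined.

Definition rep_zob : rep.
Proof.
exists (fun=> 'rV[k]_0) (fun v _ => 0) => // v a x y.
by rewrite scaler0 addr0.
Defined.

Definition rep_cat : addcat.
Proof.
refine (@AddCat rep (fun M N => rep_hom M N) rep_id rep_comp _ _ _ _ _ rep_zob _).
- by move=> M N P Q h g f; exact: rep_hom_ext.
- by move=> M N f; exact: rep_hom_ext.
- by move=> M N f; exact: rep_hom_ext.
- by move=> M N P g g' f; exact: rep_hom_ext.
- by move=> M N P g f f'; apply: rep_hom_ext => v x; exact: linearD.
- by apply: rep_hom_ext => v x; exact: thinmx0.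
Defined.

Definition injective_rep (E : rep) :=
  forall (M N : rep) (f : rep_hom M N) (g : rep_hom M E),
    (forall v, injective (@rhom M N f v)) ->
    exists h : rep_hom N E, rep_comp h f = g.

Fact injective_rep_zob : injective_rep rep_zob.
Proof.
move=> M N f g _; exists 0; apply: rep_hom_ext => v x.
by rewrite [RHS]thinmx0 [LHS]thinmx0.
Qed.

Definition inj_cat : addcat := full_subcat (C := rep_cat) injective_rep_zob.

(* K(Inj A) *)
Definition KInj : addcat := homotopy_cat inj_cat.

End Representations.

Arguments arrow {k n} _ {v} _.
Arguments rhom {k n M N} _ {v} _.
Arguments rep_cat : clear implicits.
Arguments inj_cat : clear implicits.
Arguments KInj : clear implicits.

Lemma linear_extension (k : fieldType) (U V W : lmodType k)
    (f : {linear U -> V}) (g : {linear U -> W}) :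
  injective f -> exists h : {linear V -> W}, forall u, h (f u) = g u.
Proof.
move=> f_inj.
pose lin (G : set (V * W)%type) := forall a p q, G p -> G q -> G (a *: p + q).
pose good (G : set (V * W)%type) :=
  [/\ (forall u, G (f u, g u)), lin G & forall w, G (0, w) -> w = 0].
have [G0 [G0fg G0lin G0fun]] : exists G, good G.
  exists [set (f u, g u) | u in setT]; split=> [u|a _ _ [u _ <-] [u' _ <-]|w].
  - by exists u.
  - by exists (a *: u + u') => //; rewrite !linearP.
  - by move=> [u _ [fu0 <-]]; rewrite (f_inj u 0) ?linear0.
pose P (G : set (V * W)%type) := G = set0 \/ good G.
have [|G [PG Gmax]] := @Zorn_bigcup _ P.
  move=> F FP Ftot.
  have [[G [FG gG]]|noG] := pselect (exists G, F G /\ good G); last first.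
    left; apply/seteqP; split=> // p [G FG Gp].
    by have [G_0|gG] := FP _ FG; [rewrite G_0 in Gp | case: noG; exists G].
  right; split=> [u|a p q [A FA Ap] [B FB Bq]|w [A FA Aw]].
  - by exists G => //; have [] := gG.
  - have [AB|BA] := Ftot _ _ FA FB.
    + exists B => //; have [B0|[_ linB _]] := FP _ FB; first by rewrite B0 in Bq.
      by apply: linB => //; exact: AB.
    + exists A => //; have [A0|[_ linA _]] := FP _ FA; first by rewrite A0 in Ap.
      by apply: linA => //; exact: BA.
  - have [A0|[_ _ funA]] := FP _ FA; first by rewrite A0 in Aw.
    exact: funA.
have {PG} [Gfg Glin Gfun] : good G.
  case: PG => // G_0; case: (Gmax G0); last by right.
  by rewrite G_0; split=> // /(_ _ (G0fg 0)).
have G00 : G (0, 0) by have := Gfg 0; rewrite !linear0.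
have Guniq v w w' : G (v, w) -> G (v, w') -> w = w'.
  move=> Gw Gw'; apply/eqP; rewrite -subr_eq0; apply/eqP; apply: Gfun.
  have := Glin (-1) _ _ Gw' Gw; congr G; congr pair => /=.
    by rewrite scaleN1r addNr.
  by rewrite scaleN1r addrC.
have Gtot v : exists w, G (v, w).
  apply: contrapT => noG.
  pose G' := [set p : (V * W)%type | exists a q, G q /\ p = (a *: v + q.1, q.2)].
  case: (Gmax G').
    split=> [p Gp|sub]; first by exists 0, p; rewrite scale0r add0r; case: p Gp.
    by apply: noG; exists 0; apply: sub; exists 1, (0, 0); rewrite scale1r addr0.
  right; split=> [u|b _ _ [a [p [Gp ->]]] [c [q [Gq ->]]]|w [a [[x y] [Gq]]]].
  - by exists 0, (f u, g u); rewrite scale0r add0r.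
  - exists (b * a + c), (b *: p + q); split; first exact: Glin.
    by congr pair => /=; rewrite scalerDr scalerDl scalerA addrACA.
  - case=> /= avx ->; apply: Gfun.
    have [a0|a0] := eqVneq a 0; first by move: avx; rewrite a0 scale0r add0r => ->.
    case: noG; exists (- a^-1 *: y).
    have -> : v = - a^-1 *: x.
      have -> : x = - (a *: v) by apply/eqP; rewrite -addr_eq0 addrC avx.
      by rewrite scaleNr scalerN opprK scalerA mulVf ?scale1r.
    by have := Glin (- a^-1) _ _ Gq G00; rewrite addr0.
have [h hG] : exists h : V -> W, forall v, G (v, h v).
  by exists (fun v => sval (cid (Gtot v))) => v; case: cid.
have h_lin : linear h.
  by move=> a x y; apply: (Guniq (a *: x + y)) => //; exact: Glin (hG x) (hG y).
pose H : {linear V -> W} :=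
  HB.pack h (GRing.isLinear.Build k V W *:%R h h_lin).
by exists H => u; exact: (Guniq (f u)) (hG _) (Gfg u).
Qed.

(* The injective module I_j, dual to the space of paths ending at j: its      *)
(* component at v is spanned by the dual of the trivial path if v = j (this   *)
(* is the socle) and by the dual of the arrow v -> j if ordS v = j (this      *)
(* is the top). The booleans v == j and ordS v == j are used as dimensions.   *)

Section Injectives.
Variables (k : fieldType) (n : nat).
Implicit Types j v : 'I_n.

Definition inj_space j v : lmodType k :=
  ('rV[k]_(v == j) * 'rV[k]_(ordS v == j))%type.

Definition inj_arrow j v (x : inj_space j v) : inj_space j (ordS v) := (x.2, 0).

Fact inj_arrow_linear j v : linear (@inj_arrow j v).
Proof. by move=> a x y; congr pair; rewrite /= scaler0 addr0. Qed.

Definition inj_rep j : rep k n :=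
  @Rep k n (inj_space j) (@inj_arrow j) (@inj_arrow_linear j)
    (fun v x => erefl).

Lemma inj_rep_injective j : injective_rep (inj_rep j).
Proof.
move=> M N f g f_inj.
have g1_lin v : linear (fun x : M v => (rhom g x).1).
  by move=> a x y; rewrite linearP.
pose g1 v : {linear M v -> 'rV[k]_(v == j)} :=
  HB.pack (fun x : M v => (rhom g x).1)
    (GRing.isLinear.Build k _ _ *:%R _ (g1_lin v)).
pose s v := sval (cid (linear_extension (g1 v) (f_inj v))).
have sP v (x : M v) : s v (rhom f x) = (rhom g x).1.
  exact: (svalP (cid (linear_extension (g1 v) (f_inj v))) x).
pose h v (x : N v) : inj_space j v := (s v x, s (ordS v) (arrow N x)).
have h_lin v : linear (h v).
  by move=> a x y; rewrite /h !linearP.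
have h_arrow v (x : N v) : h _ (arrow N x) = arrow (inj_rep j) (h v x).
  by rewrite /h arrow_arrow linear0.
exists (@RepHom k n N (inj_rep j) h h_lin h_arrow); apply: rep_hom_ext => v x.
rewrite [LHS]/= /h -rhom_arrow !sP /= rhom_arrow.
by case: (rhom g x).
Qed.

(* The socle of I_j is the line at j given by the first component. *)
Lemma inj_rep_soc j v (x : inj_rep j v) : arrow (inj_rep j) x = 0 <-> x.2 = 0.
Proof.
by split=> h; [exact: (congr1 fst h) | rewrite /= /inj_arrow h].
Qed.

(* The composite I_j -> I_j / soc I_j = rad I_j' -> I_j' when ordS j' = j. *)
Definition inj_diff_fun j j' v (x : inj_space j v) : inj_space j' v :=
  (x.2 *m const_mx 1, 0).

Fact inj_diff_linear j j' v : linear (@inj_diff_fun j j' v).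
Proof.
move=> a x y; rewrite /inj_diff_fun; congr pair => /=.
  by rewrite mulmxDl -scalemxAl.
by rewrite scaler0 addr0.
Qed.

Fact inj_diff_arrow j j' v (x : inj_rep j v) :
  inj_diff_fun j' (arrow (inj_rep j) x) = arrow (inj_rep j') (inj_diff_fun j' x).
Proof. by congr pair; exact: mul0mx. Qed.

Definition inj_diff j j' : rep_hom (inj_rep j) (inj_rep j') :=
  @RepHom k n (inj_rep j) (inj_rep j') (@inj_diff_fun j j')
    (@inj_diff_linear j j') (@inj_diff_arrow j j').

(* The kernel of d is the socle, and its image is the radical. *)
Lemma inj_diff_ker j' v (x : inj_rep (ordS j') v) :
  rhom (inj_diff (ordS j') j') x = 0 <-> arrow (inj_rep (ordS j')) x = 0.
Proof.
case: x => s t; rewrite /= /inj_diff_fun /inj_arrow /=.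
suff e : t *m const_mx 1 = 0 :> 'rV[k]_(v == j') <-> t = 0.
  split=> h; first by have /e -> := congr1 fst h.
  by have /= t0 := congr1 fst h; rewrite t0 mul0mx.
move: t; rewrite /= (inj_eq (@ordS_inj n)) => t.
split=> [|->]; last by rewrite mul0mx.
case: (v == j') t => /= t; last by rewrite !thinmx0.
by rewrite [const_mx 1]mx11_scalar mxE mulmx1.
Qed.

Lemma inj_diff_im j' v (y : inj_rep j' (ordS v)) :
  (exists x, rhom (inj_diff (ordS j') j') x = y) <->
  (exists z : inj_rep j' v, arrow (inj_rep j') z = y).
Proof.
case: y => s t; split=> [[x [es et]]|[z [es et]]].
  by exists (0, s); rewrite /= /inj_arrow /= -et.
exists (0, s *m const_mx 1); rewrite /= /inj_diff_fun /= -et.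
congr pair; rewrite -mulmxA.
case: (ordS v == j') (ordS (ordS v) == ordS j') (inj_eq (@ordS_inj n) (ordS v) j') s {es}
  => -[] // _ s; last by rewrite !thinmx0.
by rewrite [const_mx 1]mx11_scalar mxE mulmx1 mulmx1.
Qed.

Definition inj_obj j : inj_cat k n :=
  exist (@injective_rep k n) (inj_rep j) (@inj_rep_injective j).

Hypothesis n_gt0 : (0 < n)%N.

Fact vertex_proof (z : int) : (`|(z %% n)%Z| < n)%N.
Proof.
by rewrite -ltz_nat gez0_abs ?ltz_pmod // modz_ge0 // eqz_nat -lt0n.
Qed.

Definition vertex (z : int) : 'I_n := Ordinal (vertex_proof z).

Lemma vertexS (z : int) : vertex (z + 1) = ordS (vertex z).
Proof.
apply: val_inj => /=; apply/eqP; rewrite -eqz_nat -modz_nat gez0_abs.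
  rewrite -addn1 PoszD gez0_abs ?modzDml //.
  by rewrite modz_ge0 // eqz_nat -lt0n.
by rewrite modz_ge0 // eqz_nat -lt0n.
Qed.

(* The term in degree i is I_(1 - i). *)
Definition periodic_diff (i i' : int) :
    hom (inj_obj (vertex (1 - i))) (inj_obj (vertex (1 - i'))) :=
  if i' == i + 1 then inj_diff (vertex (1 - i)) (vertex (1 - i')) else 0.

Fact periodic_diff_degree i i' : i' != i + 1 -> periodic_diff i i' = 0.
Proof. by rewrite /periodic_diff => /negbTE ->. Qed.

Fact periodic_diff_diff i i' i'' : periodic_diff i' i'' \oc periodic_diff i i' = 0.
Proof.
rewrite /periodic_diff; case: ifP => _; last exact: comp0m.
case: ifP => _; last exact: compm0.
by apply: rep_hom_ext => v x; congr pair; exact: mul0mx.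
Qed.

Definition periodic_complex : complex (inj_cat k n) :=
  @Complex (inj_cat k n) (fun i => inj_obj (vertex (1 - i))) periodic_diff
    periodic_diff_degree periodic_diff_diff.

End Injectives.

Arguments periodic_complex k {n} n_gt0.

(* Main.v *)
From HB Require Import structures.
Require Import Defs.
From mathcomp Require Import all_boot all_order all_algebra.
From mathcomp Require Import all_classical constructive_ereal.

(** Write $\alpha$ for the action of the arrows. An injective representation $E$ satisfies
$ker \alpha = im \alpha$, and this subspace, the socle, controls $E$: linear maps
into the socle extend from the socle of one injective to a morphism, and an endomorphism
that is the identity on the socle is invertible. Hence a complex $X$ of injectives is
contractible if the subcomplex of its socles is exact ([socle_exact_contractible]).

The terms $I_j$ of the periodic complex are free on their top and cofree on their
socle. So a chain map from a truncation $T$ to $X$ is a sequence of elements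
$\tau_i$ of $X^i$ with $d \tau_i = \alpha \tau_{i + 1}$, and a chain map from $X$ to
$T$ is a sequence of functionals $\psi_i$ with $\psi_{i + 1} d = \psi_i \alpha$
([string_map_of_elements], [string_map_of_functionals]). Both live on a diagonal of
$X$, along which the degree increases and the vertex decreases. On such a diagonal
$d \alpha^{-1}$ is a linear relation that induces an honest linear map on the homology
of the socles, that is, a representation of a linearly oriented line by spaces of
arbitrary dimension. Such a representation need not be a sum of intervals, but if it
is not zero it has an interval as a direct summand ([interval_data_exists]). This is
the argument by which a nonzero module over a complete discrete valuation ring has a
cyclic or divisible uniserial summand: look at vectors that die at once and
at how far they can be lifted. So every $X$ that is not contractible has a truncation $T$
as a direct summand ([string_summand]), and an indecomposable $X$ is isomorphic to $T$.

Conversely an endomorphism of $T$ acts on all socles by one scalar, null-homotopic ones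
act by zero, and those that act by zero have square zero. Thus idempotents of $T$ are
trivial and $T$ is not contractible ([string_indecomposable]).

For endofiniteness, let $X$ be compact and $L = Hom(X, T)$. The components of $T$ have
finite dimension, so the product $T^L$ is also a coproduct of copies of $T$, indexed by a basis
of $k^L$. Compactness applied to the tautological map from $X$ to $T^L$ shows that finitely
many maps span $Hom(X, T)$ over $k$ ([compact_finite_span]). As $k$ acts through
$End(T)$, the length is at most the number of these maps ([finite_length_spanned]). *)

Set Implicit Arguments.
Unset Strict Implicit.
Unset Printing Implicit Defensive.

Import Defs.
Import Order.TTheory GRing.Theory Num.Theory.

Local Open Scope classical_set_scope.
Local Open Scope ring_scope.
Local Open Scope addcat_scope.

(** * Linear algebra in arbitrary dimension *)

Section Subspace.
Variables (k : fieldType) (V : lmodType k) (N : {pred V}).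
Hypothesis NP : GRing.submod_closed N.

Definition sub_pred of GRing.submod_closed N : {pred V} := N.
HB.instance Definition _ := GRing.isSubmodClosed.Build k V (sub_pred NP) NP.

Definition subspace : Type := {x : V | x \in sub_pred NP}.
HB.instance Definition _ := SubType.copy subspace {x : V | x \in sub_pred NP}.
HB.instance Definition _ := Choice.copy subspace {x : V | x \in sub_pred NP}.
HB.instance Definition _ := [SubChoice_isSubLmodule of subspace by <:].

Definition in_subspace (x : V) (Nx : x \in N) : subspace := exist _ x Nx.

Lemma in_subspace_linear (U : lmodType k) (f : U -> V) (Nf : forall u, f u \in N) :
  linear f -> linear (fun u => in_subspace (Nf u)).
Proof. by move=> fl a x y; apply: val_inj; rewrite /= fl. Qed.

Lemma subspaceP (x : subspace) : val x \in N. Proof. exact: (valP x). Qed.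

End Subspace.

Definition mk_linear (k : fieldType) (U V : lmodType k) (f : U -> V)
    (fl : linear f) : {linear U -> V} :=
  HB.pack f (GRing.isLinear.Build k U V *:%R f fl).

Section LinearAlgebra.
Variable k : fieldType.
Implicit Types U V W : lmodType k.

Lemma ker_closed U V (f : {linear U -> V}) :
  GRing.submod_closed [pred u | f u == 0].
Proof.
split=> [|a x y]; rewrite !inE ?linear0 // linearP => /eqP-> /eqP->.
by rewrite scaler0 addr0.
Qed.

(** Every linear map has a one-sided inverse up to itself: split off the kernel,
on a complement of which the map is injective and can be inverted. *)
Lemma pseudo_inverse_total U V (f : {linear U -> V}) :
  exists g : {linear V -> U}, forall u, f (g (f u)) = f u.
Proof.
pose K := subspace (ker_closed f).
have [|p pP] := @linear_extension k K U K (val : {linear K -> U}) idfun.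
  exact: val_inj.
pose K' := subspace (ker_closed p).
have fK' : injective (f \o (val : {linear K' -> U})).
  move=> x y /= fxy; apply/val_inj/eqP; rewrite -subr_eq0; apply/eqP.
  have fxy0 : val x - val y \in [pred u | f u == 0].
    by rewrite inE linearB /= fxy subrr.
  have := pP (in_subspace (ker_closed f) fxy0).
  rewrite /= linearB /= (eqP (subspaceP x)) (eqP (subspaceP y)) subrr.
  by move=> /(congr1 val) /= <-.
have [g gP] := @linear_extension k K' V U (f \o (val : {linear K' -> U}))
  (val : {linear K' -> U}) fK'.
exists g => u.
have fp : f (val (p u)) = 0 by exact/eqP/(subspaceP (p u)).
have pu : u - val (p u) \in [pred u | p u == 0].
  by rewrite inE linearB /= pP subrr.
have := gP (in_subspace (ker_closed p) pu); rewrite /= linearB /= fp subr0 => ->.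
by rewrite linearB /= fp subr0.
Qed.

(** The pseudo-inverse of the restriction of $f$ to $N$; contractions of socle
subcomplexes are built from it without leaving the ambient spaces. *)
Lemma pseudo_inverse U V (f : {linear U -> V}) (N : {pred U}) :
  GRing.submod_closed N ->
  exists g : {linear V -> U},
    (forall v, g v \in N) /\ forall u, u \in N -> f (g (f u)) = f u.
Proof.
move=> NP; pose K := subspace NP.
have [g gP] := pseudo_inverse_total (f \o (val : {linear K -> U})).
exists ((val : {linear K -> U}) \o g); split=> [v|u Nu] /=.
  exact: (subspaceP (g v)).
exact: (gP (in_subspace NP Nu)).
Qed.

Lemma factor_linear U V W (f : {linear U -> V}) (g : {linear U -> W}) :
  (forall u, f u = 0 -> g u = 0) ->
  exists h : {linear V -> W}, forall u, h (f u) = g u.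
Proof.
move=> kfg; have [q qP] := pseudo_inverse_total f.
exists (g \o q) => u; apply/eqP; rewrite -subr_eq0 /= -linearB; apply/eqP/kfg.
by rewrite linearB /= qP subrr.
Qed.

(** The only obstruction to extending a map along $a$ by zero on $N$ is a vector of
$a(U) \cap N$ on which the two requirements disagree. *)
Lemma linear_extension_vanishing U V W (a : {linear U -> V}) (g : {linear U -> W})
    (N : {pred V}) : GRing.submod_closed N ->
  (forall u, a u \in N -> g u = 0) ->
  exists h : {linear V -> W},
    (forall u, h (a u) = g u) /\ forall x, x \in N -> h x = 0.
Proof.
move=> NP aN; pose K := subspace NP.
have fl : linear (fun p : U * K => a p.1 - val p.2).
  move=> c x y /=; rewrite linearP opprD scalerBr addrACA; congr (_ + _).
have gl : linear (fun p : U * K => g p.1).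
  by move=> c x y; rewrite !linearP.
have [|h hP] := @factor_linear _ _ _ (mk_linear fl) (mk_linear gl).
  move=> [u x] /= /eqP; rewrite subr_eq0 => /eqP au.
  by apply: aN; rewrite au; exact: (subspaceP x).
exists h; split=> [u|x Nx].
  by have := hP (u, 0); rewrite /= subr0.
have := hP (0, in_subspace NP Nx); rewrite /= !linear0 sub0r.
by rewrite linearN => /eqP; rewrite oppr_eq0 => /eqP.
Qed.

Lemma functional_vanishing V (b : V) (N : {pred V}) : GRing.submod_closed N ->
  b \notin N ->
  exists h : {linear V -> k^o}, h b = 1 /\ forall x, x \in N -> h x = 0.
Proof.
move=> NP Nb.
have al : linear (fun c : k^o => c *: b).
  by move=> c x y; rewrite scalerDl scalerA.
have [|h [hb hN]] := @linear_extension_vanishing _ _ _ (mk_linear al) idfun N NP.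
  move=> c /= Ncb; apply/eqP; apply: contraNT Nb => c0.
  have := NP.2 c^-1 _ _ Ncb NP.1; rewrite addr0.
  by rewrite scalerA mulVf ?scale1r.
by exists h; split=> //; have := hb 1; rewrite /= scale1r.
Qed.

End LinearAlgebra.

Section Basis.
Variables (k : fieldType) (V : lmodType k).
Implicit Types (B S : set V) (x : V).

(** The intersection of all subspaces containing $S$: the definition is at once the
induction principle of the span. *)
Definition span S : {pred V} :=
  [pred x | `[< forall N : {pred V},
    GRing.submod_closed N -> (forall s, S s -> s \in N) -> x \in N >]].

Lemma span_closed S : GRing.submod_closed (span S).
Proof.
split=> [|a x y]; rewrite !inE; first by move=> N [].
by move=> Sx Sy N NP SN; apply: NP.2; [exact: Sx | exact: Sy].
Qed.

Lemma sub_span S x : S x -> x \in span S.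
Proof. by move=> Sx; rewrite inE => N _; apply. Qed.

Lemma span_min S (N : {pred V}) : GRing.submod_closed N ->
  (forall s, S s -> s \in N) -> {subset span S <= N}.
Proof. by move=> NP SN x; rewrite inE; apply. Qed.

Lemma spanS S S' : S `<=` S' -> {subset span S <= span S'}.
Proof.
move=> SS'; apply: span_min (span_closed _) _ => s /SS'; exact: sub_span.
Qed.

(** The exchange step in the proof that a maximal independent set spans. *)
Lemma span_setU1 S x y : y \in span (x |` S) ->
  exists c z, z \in span S /\ y = z + c *: x.
Proof.
pose N : {pred V} :=
  [pred y | `[< exists c z, z \in span S /\ y = z + c *: x >]].
have [S0 SP] := span_closed S.
suff sN : {subset span (x |` S) <= N} by move=> /sN; rewrite inE.
apply: span_min => [|s [->|Ss]].
- split=> [|a u w]; rewrite !inE; first by exists 0, 0; rewrite scale0r addr0.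
  move=> [c [z [Sz ->]]] [c' [z' [Sz' ->]]].
  exists (a * c + c'), (a *: z + z'); split; first exact: SP.
  by rewrite scalerDr scalerDl scalerA addrACA.
- by rewrite inE; exists 1, 0; rewrite scale1r add0r.
- by rewrite inE; exists 0, s; rewrite scale0r addr0; split=> //; exact: sub_span.
Qed.

Definition independent B := forall b, B b -> b \notin span (B `\ b).

Lemma independent_bigcup (F : set (set V)) : F `<=` independent ->
  total_on F subset -> independent (\bigcup_(B in F) B).
Proof.
move=> FI Ftot b [B FB Bb]; apply/negP => sb.
pose N : {pred V} := [pred x | `[< exists2 A, F A & x \in span (A `\ b) >]].
have : b \in N.
  apply: span_min sb => [|s [[A FA As] sb]]; last first.
    by rewrite inE; exists A => //; apply: sub_span.
  split=> [|a x y]; rewrite !inE; first by exists B => //; case: (span_closed (B `\ b)).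
  move=> [A FA xA] [A' FA' yA'].
  wlog AA' : a x y A A' FA FA' xA yA' / A `<=` A' => [wl|].
    have [|A'A] := Ftot _ _ FA FA'; first exact: wl xA yA'.
    exists A => //; apply: (span_closed _).2 => //.
    by apply: spanS yA' => s [/A'A].
  exists A' => //; apply: (span_closed _).2 => //.
  by apply: spanS xA => s [/AA'].
rewrite inE => -[A FA bA].
have [AB|BA] := Ftot _ _ FA FB.
  by have /negP := FI _ FB _ Bb; apply; apply: spanS bA => s [/AB].
by have /negP := FI _ FA _ (BA _ Bb).
Qed.

Lemma independent_spanning : exists B, independent B /\ forall x, x \in span B.
Proof.
have [B [BI Bmax]] := Zorn_bigcup independent_bigcup.
exists B; split=> // x; apply: contrapT => /negP xB.
have xB' : ~ B x by move=> Bx; move/negP: xB; apply; exact: sub_span.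
apply: (Bmax (x |` B)).
  by split=> [s Bs|sub]; [right | apply/xB'/sub; left].
move=> b [->|Bb].
  apply: contra xB; apply: spanS => s [[->|//]].
  by move=> /(_ erefl).
have nbx : b <> x by move=> bx; apply: xB'; rewrite -bx.
apply/negP => sb; have : b \in span (x |` (B `\ b)).
  by apply: spanS sb => s [[->|Bs] ns]; [left | right].
move=> /span_setU1[c [z [Sz bE]]].
have [c0|c0] := eqVneq c 0.
  by move: bE; rewrite c0 scale0r addr0 => bz; have /negP := BI _ Bb; rewrite {1}bz.
move/negP: xB; apply.
have -> : x = (- c^-1) *: z + c^-1 *: b.
  by rewrite bE scalerDr scalerA mulVf // scale1r scaleNr addKr.
apply: (span_closed _).2; first by apply: spanS Sz => s [].
rewrite -[_ *: b]addr0; apply: (span_closed _).2; first exact: sub_span.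
by case: (span_closed B).
Qed.

(** A basis is recorded by its universal property, the form in which it is used
for coproducts. Extending $f$ linearly only requires the dual functionals
$phi_b$, which exist because $b$ is not in the span of the other vectors. *)
Theorem basis_exists : exists (J : choiceType) (b : J -> V),
  forall (W : lmodType k) (f : J -> W),
    (exists g : {linear V -> W}, forall j, g (b j) = f j) /\
    (forall g g' : {linear V -> W}, (forall j, g (b j) = g' (b j)) -> g =1 g').
Proof.
have [B [BI Bspan]] := independent_spanning.
exists {x : V | x \in B}, val => W f; split; last first.
  move=> g g' gg' x; apply/eqP; rewrite -subr_eq0.
  pose N : {pred V} := [pred x | g x - g' x == 0].
  suff : x \in N by [].
  apply: span_min (Bspan x) => [|s Bs].
    split=> [|a y z]; rewrite !inE; first by rewrite !linear0 addr0.
    move=> /eqP gy /eqP gz.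
    by rewrite !linearP addrACA -scalerDr gy gz scaler0 addr0.
  rewrite inE; have /= -> := gg' (exist _ s (mem_set Bs)).
  by rewrite subrr.
have coordP b : exists phi : {linear V -> k^o}, B b ->
    phi b = 1 /\ forall b', B b' -> b' <> b -> phi b' = 0.
  have [Bb|nBb] := pselect (B b); last by exists \0.
  have [phi [phib phi0]] := functional_vanishing (span_closed _) (BI _ Bb).
  by exists phi => _; split=> // b' Bb' b'b; apply/phi0/sub_span.
pose phi b := sval (cid (coordP b)).
have phiP b : B b -> phi b b = 1 /\ forall b', B b' -> b' <> b -> phi b b' = 0.
  exact: (svalP (cid (coordP b))).
pose F (b : V) : W := if @idP (b \in B) is ReflectT Bb then f (exist _ b Bb) else 0.
(* The graph of the extension: w is the sum of phi_b(x) f(b) over any finite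
   set of basis vectors that is large enough for x. *)
pose G x w := exists s : seq V, (forall b, b \in s -> B b) /\
  forall s', uniq s' -> {subset s <= s'} ->
  (forall b, b \in s' -> B b) -> (\sum_(b <- s') phi b x *: F b = w).
have Guniq x w w' : G x w -> G x w' -> w = w'.
  move=> [s [sB sP]] [s' [s'B s'P]]; pose s'' := undup (s ++ s').
  have s''B b : b \in s'' -> B b.
    by rewrite mem_undup mem_cat => /orP[/sB|/s'B].
  rewrite -(sP s'') ?undup_uniq //; last first.
    by move=> b bs; rewrite mem_undup mem_cat bs.
  rewrite (s'P s'') ?undup_uniq //.
  by move=> b bs; rewrite mem_undup mem_cat bs orbT.
have Glin a x y w w' : G x w -> G y w' -> G (a *: x + y) (a *: w + w').
  move=> [s [sB sP]] [s' [s'B s'P]]; exists (s ++ s'); split=> [b|r ru sr rB].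
    by rewrite mem_cat => /orP[/sB|/s'B].
  rewrite -(sP r) // => [|b bs]; last by apply: sr; rewrite mem_cat bs.
  rewrite -(s'P r) // => [|b bs]; last by apply: sr; rewrite mem_cat bs orbT.
  rewrite scaler_sumr -big_split /=; apply: eq_bigr => b _.
  by rewrite linearP scalerDl scalerA.
have Gb b (Bb : b \in B) : G b (f (exist _ b Bb)).
  have Bb' : B b by rewrite inE in Bb.
  exists [:: b]; split=> [b'|r ru sr rB]; first by rewrite inE => /eqP->.
  rewrite (big_rem b) /=; last by apply: sr; rewrite inE.
  have [-> _] := phiP _ Bb'; rewrite scale1r big_seq big1 => [|b'].
    rewrite addr0 /F; case: {-}_ / idP => // Bb2.
    by congr f; apply: val_inj.
  rewrite mem_rem_uniq // inE => /andP[/eqP b'b /rB Bb2].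
  by have [_ ->] := phiP _ Bb2; rewrite ?scale0r // => bb'; apply: b'b.
have Gtot x : exists w, G x w.
  pose N : {pred V} := [pred x | `[< exists w, G x w >]].
  suff : x \in N by rewrite inE.
  apply: span_min (Bspan x) => [|s Bs]; last first.
    by rewrite inE; eexists; exact: (Gb _ (mem_set Bs)).
  split=> [|a y z]; rewrite !inE.
    exists 0, [::]; split=> // r _ _ _; apply: big1 => b _.
    by rewrite linear0 scale0r.
  by move=> [w yw] [w' zw']; exists (a *: w + w'); exact: Glin.
pose g x := sval (cid (Gtot x)).
have gP x : G x (g x) by exact: (svalP (cid (Gtot x))).
have gl : linear g by move=> a x y; apply: Guniq (gP _) _; exact: Glin.
by exists (mk_linear gl) => -[b Bb]; apply: Guniq (gP _) _; exact: Gb.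
Qed.

End Basis.

(** * Linear relations along the integers *)

(** Families indexed by the integers are built by choosing successively to the right
and to the left of a base point. The types of the members depend on the index,
hence the transports. *)
Section IntChain.
Variables (T : int -> Type).

Definition transport t t' (e : t = t') (y : T t) : T t' := eq_rect t T y t' e.

Lemma transport_id t (e : t = t) y : transport e y = y.
Proof. by rewrite /transport (eq_axiomK e). Qed.

Lemma transport_comp t t' t'' (e : t = t') (e' : t' = t'') (e'' : t = t'') y :
  transport e' (transport e y) = transport e'' y.
Proof. by subst; rewrite !transport_id. Qed.

Lemma int_iteration i (x : T i) (up : forall t, i <= t -> T t -> T (t + 1))
    (down : forall t, t < i -> T (t + 1) -> T t) :
  exists f : forall t, T t, [/\ f i = x,
    forall t (it : i <= t), f (t + 1) = up t it (f t)
  & forall t (ti : t < i), f t = down t ti (f (t + 1))].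
Proof.
have e0 : i = i + 0%:Z by rewrite addr0.
have e0' : i = i - 0%:Z by rewrite subr0.
have eu n : i + n%:Z + 1 = i + n.+1%:Z by rewrite -addn1 PoszD addrA.
have ed n : i - n%:Z = i - n.+1%:Z + 1.
  by rewrite -addn1 PoszD opprD addrA subrK.
have lu n : i <= i + n%:Z by rewrite lerDl.
have ld n : i - n.+1%:Z < i by rewrite gtrBl.
pose u := nat_rect (fun n => T (i + n%:Z)) (transport e0 x)
  (fun n y => transport (eu n) (up _ (lu n) y)).
pose d := nat_rect (fun n => T (i - n%:Z)) (transport e0' x)
  (fun n y => down _ (ld n) (transport (ed n) y)).
have uE n m (e : i + n%:Z = i + m%:Z) : transport e (u n) = u m.
  have [nm] : n%:Z = m%:Z by apply: (addrI i).
  by subst m; rewrite transport_id.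
have dE n m (e : i - n%:Z = i - m%:Z) : transport e (d n) = d m.
  have [nm] : n%:Z = m%:Z by apply/oppr_inj/(addrI i).
  by subst m; rewrite transport_id.
have udE n m (e : i + n%:Z = i - m%:Z) : transport e (u n) = d m.
  have nm : n%:Z = - m%:Z by apply: (addrI i).
  have [n0 m0] : n = 0%N /\ m = 0%N by case: (n) (m) nm => [|?] [|?].
  by subst n m; rewrite /= (transport_comp _ _ e0').
have fP t : exists y : T t, (forall n (e : i + n%:Z = t), transport e (u n) = y) /\
    (forall n (e : i - n%:Z = t), transport e (d n) = y).
  have [it|ti] := leP i t.
    have e : i + `|t - i|%:Z = t by rewrite gez0_abs ?subr_ge0 ?subrKC.
    exists (transport e (u _)); split=> n e'.
      by rewrite -(uE _ _ (etrans e' (esym e))) (transport_comp _ _ e').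
    by rewrite -(udE _ _ (etrans e (esym e'))) (transport_comp _ _ e).
  have e : i - `|t - i|%:Z = t.
    by rewrite ltz0_abs ?subr_lt0 // opprK subrKC.
  exists (transport e (d _)); split=> n e'.
    by rewrite -(udE _ _ (etrans e' (esym e))) (transport_comp _ _ e').
  by rewrite -(dE _ _ (etrans e' (esym e))) (transport_comp _ _ e').
pose f t := sval (cid (fP t)).
have fu t n (e : i + n%:Z = t) : f t = transport e (u n).
  by rewrite (svalP (cid (fP t))).1.
have fd t n (e : i - n%:Z = t) : f t = transport e (d n).
  by rewrite (svalP (cid (fP t))).2.
exists f; split=> [|t it|t ti].
- by rewrite (fu _ _ (esym e0)) /= (transport_comp _ _ erefl).
- have [n e] : exists n : nat, i + n%:Z = t.
    by exists `|t - i|%N; rewrite gez0_abs ?subr_ge0 ?subrKC.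
  subst t; rewrite (fu _ n erefl) (fu _ n.+1 (esym (eu n))) /=.
  rewrite (transport_comp _ _ erefl) /=.
  by congr up; exact: Prop_irrelevance.
- have [n e] : exists n : nat, i - n.+1%:Z = t.
    exists `|t - i|.-1; rewrite prednK ?absz_gt0 ?subr_eq0 ?lt_eqF //.
    by rewrite ltz0_abs ?subr_lt0 // opprK subrKC.
  subst t; rewrite (fd _ n.+1 erefl) (fd _ n (ed n)) /=.
  by congr down; exact: Prop_irrelevance.
Qed.

End IntChain.

(** The choices to the right keep $P$ from $t$ to $t + 1$, those to the left from
$t + 1$ to $t$; both are linked by the same relation $R$. *)
Lemma int_dependent_choice (T : int -> Type) (P : forall t, T t -> Prop)
    (R : forall t, T t -> T (t + 1) -> Prop) i (x : T i) :
  P i x ->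
  (forall t (y : T t), i <= t -> P t y -> exists z, P (t + 1) z /\ R t y z) ->
  (forall t z, t < i -> P (t + 1) z -> exists y, P t y /\ R t y z) ->
  exists f : forall t, T t,
    f i = x /\ forall t, P t (f t) /\ R t (f t) (f (t + 1)).
Proof.
move=> Px up down; pose T' t := {y : T t | P t y}.
have upP t (it : i <= t) (y : T' t) :
    exists z : T' (t + 1), R t (sval y) (sval z).
  have [z [Pz Rz]] := up t _ it (svalP y).
  by exists (exist _ z Pz).
have downP t (ti : t < i) (z : T' (t + 1)) :
    exists y : T' t, R t (sval y) (sval z).
  have [y [Py Ry]] := down t _ ti (svalP z).
  by exists (exist _ y Py).
have [f [fi fup fdown]] := int_iteration (T := T') (exist _ x Px)
  (fun t it y => sval (cid (upP t it y)))
  (fun t ti z => sval (cid (downP t ti z))).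
exists (fun t => sval (f t)); split=> [|t]; first by rewrite fi.
split; first exact: (svalP (f t)).
have [it|ti] := leP i t.
  by rewrite (fup t it); exact: (svalP (cid (upP t it (f t)))).
by rewrite (fdown t ti); exact: (svalP (cid (downP t ti (f (t + 1))))).
Qed.

Lemma in_range_convex l m (i j t : int) :
  in_range l m i -> in_range l m j -> i <= t -> t <= j -> in_range l m t.
Proof.
rewrite /in_range => /andP[li _] /andP[_ jm] it tj; apply/andP; split.
  by apply: le_trans li _; rewrite lee_fin.
by apply: le_trans jm; rewrite lee_fin.
Qed.

Lemma in_range_constant (Q : Type) (c : int -> Q) l m :
  (forall t, in_range l m t -> in_range l m (t + 1) -> c t = c (t + 1)) ->
  forall i j, in_range l m i -> in_range l m j -> c i = c j.
Proof.
move=> cS i j; wlog ij : i j / i <= j.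
  move=> wl Ii Ij; have [ij|/ltW ji] := leP i j; first exact: wl.
  by apply/esym/wl.
have [n ->] : exists n : nat, j = i + n%:Z.
  by exists `|j - i|%N; rewrite gez0_abs ?subr_ge0 ?subrKC.
elim: n => [|n IHn] Ii Ij; first by rewrite addr0.
have jn : i + n.+1%:Z = i + n%:Z + 1 by rewrite -addn1 PoszD addrA.
have In : in_range l m (i + n%:Z).
  by apply: in_range_convex Ii Ij _ _; rewrite ?lerDl // lerD2l lez_nat.
by rewrite IHn // jn; apply: cS => //; rewrite -jn.
Qed.

(** A diagram $E_t <- F_t -> E_{t + 1}$, with maps $a$ and $d$, amounts to a linear
relation $d a^{-1}$ from $E_t$ to $E_{t + 1}$ for every integer $t$. The components
along a diagonal of a complex of injectives form such a diagram, with the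
action of the arrow for $a$ and the differential for $d$. *)
Section LinearRelations.
Variables (k : fieldType) (E F : int -> lmodType k).
Variables (a : forall t, {linear F t -> E t}).
Variables (d : forall t, {linear F t -> E (t + 1)}).

(** An interval summand of the diagram: $tau$ includes the interval $[l, m]$ and
$psi$ projects onto it. Nothing relates $tau_l$ to the left, nor $psi_m$ to the
right: an inclusion only has to respect the end of the interval at $m$, a projection
its beginning at $l$. *)
Record interval_data (l m : \bar int) (tau : forall t, F t)
    (psi : forall t, {linear E t -> k^o}) : Prop := IntervalData {
  data_step : forall t, in_range l m t -> in_range l m (t + 1) ->
    d t (tau t) = a (t + 1) (tau (t + 1));
  data_top : forall t, in_range l m t -> ~~ in_range l m (t + 1) ->
    d t (tau t) = 0;
  data_dual_step : forall t, in_range l m t -> in_range l m (t + 1) ->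
    forall x, psi (t + 1) (d t x) = psi t (a t x);
  data_dual_bottom : forall t, ~~ in_range l m t -> in_range l m (t + 1) ->
    forall x, psi (t + 1) (d t x) = 0;
  data_unit : forall t, in_range l m t -> psi t (a t (tau t)) = 1 }.

(** $Z_t$ stands for the cycles of the socle. They lie in the image of $a$, and the
relation maps them to cycles and lifts cycles to cycles; its indeterminacy
consists of boundaries, which the relation can continue by zero. *)
Variable Z : forall t, E t -> Prop.
Hypothesis Z_lift : forall t (e : E t), Z e -> exists x, a t x = e.
Hypothesis Z_step : forall t (x : F t), Z (d t x) <-> Z (a t x).
Hypothesis Z0 : forall t, Z (0 : E t).
Hypothesis ker_lift : forall t (x : F t), a t x = 0 ->
  exists y, a (t + 1) y = d t x /\ d (t + 1) y = 0.

(** The common construction behind the four types of intervals. From a base point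
$i$ where $a e$ is not in $W$, elements are continued to the right as cycles and
to the left inside $U$, and functionals are continued both ways so as to vanish
on $W$. The two conditions on $W$ make each continuation consistent; $W$ contains
$d(F_{l - 1})$ so that $psi$ vanishes to the left of $l$. *)
Lemma interval_data_from l m i (e : F i) (W : forall t, {pred E t})
    (U : forall t, E t -> Prop) :
  in_range l m i ->
  (forall t, GRing.submod_closed (W t)) ->
  (forall t x, t < i -> in_range l m t -> a t x \in W t -> d t x \in W (t + 1)) ->
  (forall t x, i <= t -> in_range l m (t + 1) ->
     d t x \in W (t + 1) -> a t x \in W t) ->
  (forall t x, ~~ in_range l m t -> in_range l m (t + 1) -> d t x \in W (t + 1)) ->
  (forall t y, t < i -> in_range l m t -> U (t + 1) y ->
     exists x, d t x = y /\ U t (a t x)) ->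
  (forall t, i <= t -> in_range l m (t + 1) -> in_range l m (t + 1 + 1)) ->
  U i (a i e) -> Z (a i e) -> (~~ in_range l m (i + 1) -> d i e = 0) ->
  a i e \notin W i ->
  exists tau psi, interval_data l m tau psi.
Proof.
move=> Ii WP Wdown Wup Wbot Udown unbounded Ue Ze etop eW.
pose P t (x : F t) := in_range l m t -> (t <= i -> U t (a t x)) /\
  (i <= t -> Z (a t x) /\ (~~ in_range l m (t + 1) -> d t x = 0)).
pose R t (x : F t) (y : F (t + 1)) :=
  in_range l m t -> in_range l m (t + 1) -> d t x = a (t + 1) y.
have [|t x it Px|t y ti Py|tau [taui tauP]] := @int_dependent_choice F P R i e.
- by [].
- have [It1|nIt1] := boolP (in_range l m (t + 1)); last first.
    by exists 0; split=> [J|_ J]; rewrite J in nIt1.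
  have It : in_range l m t by apply: in_range_convex Ii It1 it _; rewrite lerDl.
  have [_ /(_ it)[Zx _]] := Px It.
  have [y yE] := Z_lift ((Z_step x).2 Zx).
  exists y; split=> // _; split=> [|_].
    by rewrite leNgt (le_lt_trans it) // ltrDl.
  by rewrite unbounded //; split=> //; rewrite yE; apply/Z_step.
- have ti1 : t + 1 <= i by rewrite lezD1.
  have [It|nIt] := boolP (in_range l m t); last first.
    by exists 0; split=> [J|J _]; rewrite J in nIt.
  have It1 : in_range l m (t + 1) by apply: in_range_convex It Ii _ _; rewrite ?lerDl.
  have [/(_ ti1) Uy _] := Py It1.
  have [x [dx Ux]] := Udown _ _ ti It Uy.
  by exists x; split=> // _; split=> // /(lt_le_trans ti); rewrite ltxx.
have [psi0 [psi0e psi0W]] := functional_vanishing (WP i) eW.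
pose P' t (f : {linear E t -> k^o}) := in_range l m t -> forall x, x \in W t -> f x = 0.
pose R' t (f : {linear E t -> k^o}) (g : {linear E (t + 1) -> k^o}) :=
  in_range l m t -> in_range l m (t + 1) -> forall x, g (d t x) = f (a t x).
have [|t f it Pf|t g ti Pg|psi [psii psiP]] :=
    @int_dependent_choice (fun t => {linear E t -> k^o}) P' R' i psi0.
- by move=> _.
- have [It1|nIt1] := boolP (in_range l m (t + 1)); last first.
    by exists \0; split=> [J|_ J]; rewrite J in nIt1.
  have It : in_range l m t by apply: in_range_convex Ii It1 it _; rewrite lerDl.
  have [|h [hd hW]] := @linear_extension_vanishing _ _ _ _ (d t) (f \o a t) _ (WP (t + 1)).
    by move=> x dxW; apply: Pf => //; exact: Wup.
  by exists h; split=> [_|_ _].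
- have ti1 : t + 1 <= i by rewrite lezD1.
  have [It|nIt] := boolP (in_range l m t); last first.
    by exists \0; split=> [J|J _]; rewrite J in nIt.
  have It1 : in_range l m (t + 1) by apply: in_range_convex It Ii _ _; rewrite ?lerDl.
  have [|h [hd hW]] := @linear_extension_vanishing _ _ _ _ (a t) (g \o d t) _ (WP t).
    by move=> x axW; apply: Pg => //; exact: Wdown.
  by exists h; split=> [_|_ _ x]; rewrite ?hd.
have step t : in_range l m t -> in_range l m (t + 1) ->
    d t (tau t) = a (t + 1) (tau (t + 1)) by exact: (tauP t).2.
have dual t : in_range l m t -> in_range l m (t + 1) ->
    forall x, psi (t + 1) (d t x) = psi t (a t x) by exact: (psiP t).2.
exists tau, psi; split=> // [t It nIt1|t nIt It1 x|t It].
- have it : i <= t.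
    rewrite leNgt; apply: contra nIt1 => ti.
    by apply: in_range_convex It Ii _ _; rewrite ?lerDl ?lezD1.
  by have [_ /(_ it)[_ ->]] := (tauP t).1 It.
- by apply: (psiP (t + 1)).1 => //; exact: Wbot.
- rewrite (@in_range_constant _ (fun t => psi t (a t (tau t))) l m _ t i) //.
    by rewrite taui psii.
  by move=> s Is Is1; rewrite -dual // step.
Qed.

(** The images under the relation $d a^{-1}$. Equality in the total space of $E$
avoids a cast from $E_{s + 1}$ to $E_t$ when $t = s + 1$. *)
Definition rel_image (N : forall t, {pred E t}) t : {pred E t} :=
  [pred y | `[< exists s (x : F s),
     existT E (s + 1) (d s x) = existT E t y /\ a s x \in N s >]].
Arguments rel_image : clear implicits.

Lemma rel_imageP N t (y : E (t + 1)) :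
  y \in rel_image N (t + 1) <-> exists x : F t, d t x = y /\ a t x \in N t.
Proof.
rewrite inE; split=> [[s [x [e xN]]]|[x [<- xN]]]; last by exists t, x.
have st : s = t by apply: (addIr 1); exact: (congr1 tag e).
subst s; exists x; split=> //.
exact: (eq_from_Tagged e).
Qed.

Lemma rel_image_closed N : (forall t, GRing.submod_closed (N t)) ->
  forall t, GRing.submod_closed (rel_image N t).
Proof.
move=> NP t; rewrite -(subrK 1 t); move: (t - 1) => {}t.
split=> [|c x y]; first by apply/rel_imageP; exists 0; rewrite !linear0 (NP t).1.
move=> /rel_imageP[u [<- uN]] /rel_imageP[v [<- vN]]; apply/rel_imageP.
by exists (c *: u + v); rewrite !linearP; split=> //; exact: (NP t).2.
Qed.

Definition image_power p : forall t, {pred E t} :=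
  iter p rel_image (fun t => predT).
Arguments image_power : clear implicits.

Lemma image_power_closed p t : GRing.submod_closed (image_power p t).
Proof.
elim: p t => [|p IHp] t; first by split.
exact: rel_image_closed.
Qed.

(** The indeterminacy of the relation, that is, the boundaries of the socle: the
vectors $d x$ with $a x = 0$. *)
Definition boundary : forall t, {pred E t} := rel_image (fun t => pred1 0).
Arguments boundary : clear implicits.

Lemma boundary_closed t : GRing.submod_closed (boundary t).
Proof.
apply: rel_image_closed => {}t; split=> [|c x y]; rewrite ?inE //.
by move=> /eqP-> /eqP->; rewrite scaler0 addr0.
Qed.

Lemma boundary_step t (x : F t) : a t x \in boundary t -> d t x \in boundary (t + 1).
Proof.
rewrite -(subrK 1 t) in x *; move: (t - 1) x => {}t x.
move=> /rel_imageP[y [dy ay]]; rewrite inE in ay.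
have [z [az dz]] := ker_lift (eqP ay).
apply/rel_imageP; exists (x - z); rewrite !linearB /= dz subr0 az dy.
by rewrite inE subrr.
Qed.

(** An element of $F_t$ is determined by its image under $d$ up to $ker d$, whose
image under $a$ is assumed to lie in $N$. *)
Lemma rel_image_up N t (x : F t) : (forall t, GRing.submod_closed (N t)) ->
  (forall y, d t y = 0 -> a t y \in N t) ->
  d t x \in rel_image N (t + 1) -> a t x \in N t.
Proof.
move=> NP kerN /rel_imageP[y [dy ay]].
have -> : a t x = 1 *: a t (x - y) + a t y.
  by rewrite scale1r linearB subrK.
by apply: (NP t).2 => //; apply: kerN; rewrite linearB /= dy subrr.
Qed.

(** Call $K_t$ the kernel $a(ker d)$ of the relation at $t$. If some vector of $K_m$ can
be lifted exactly $p$ steps to the left, it spans a summand $[m - p, m]$. Otherwise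
$K_t$ lies in all images, and a cycle that cannot be lifted at all spans a summand
unbounded to the right. If all cycles can be lifted, then a vector of some $K_m$
that is not a boundary spans a summand unbounded to the left; and if all $K_t$
consist of boundaries, the relation is bijective modulo boundaries and the given
cycle spans a summand unbounded on both sides. *)
Theorem interval_data_exists i (e : E i) : Z e -> e \notin boundary i ->
  exists l m tau psi, (exists j, in_range l m j) /\ interval_data l m tau psi.
Proof.
move=> Ze eB.
have [[m [x [p [dx xp xp1]]]]|noF] := pselect (exists m (x : F m) p,
    [/\ d m x = 0, a m x \in image_power p m & a m x \notin image_power p.+1 m]).
  pose l : int := m - p%:Z.
  have lm : in_range l%:E m%:E m by rewrite /in_range !lee_fin lexx gerBl.
  have absS (t : int) : l <= t -> absz (t + 1 - l)%R = (absz (t - l)%R).+1.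
    move=> lt; apply/eqP; rewrite -eqz_nat -addn1 PoszD !gez0_abs ?subr_ge0 //.
      by rewrite addrAC.
    by rewrite (le_trans lt) // lerDl.
  have ml : absz (m - l)%R = p by rewrite /l opprB subrKC.
  exists l%:E, m%:E.
  have [||||||||||tau [psi D]] := @interval_data_from l%:E m%:E m x
      (fun t => image_power (absz (t - l)%R).+1 t)
      (fun t y => y \in image_power (absz (t - l)%R) t) lm.
  - by move=> t; exact: image_power_closed.
  - move=> t y tm /andP[]; rewrite !lee_fin => lt _ ay.
    by rewrite absS //; apply/rel_imageP; exists y.
  - by move=> t y mt /andP[_]; rewrite lee_fin lezD1 ltNge mt.
  - move=> t y; rewrite /in_range !lee_fin => nIt /andP[lt1 t1m].
    have tl : t + 1 = l.
      apply/eqP; rewrite eq_le lt1 andbT lezD1 ltNge.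
      by apply: contra nIt => ->; rewrite (le_trans _ t1m) // lerDl.
    rewrite [X in _ \in image_power X.+1 _](_ : _ = 0%N) ?tl ?subrr //.
    by apply/rel_imageP; exists y.
  - move=> t y tm /andP[]; rewrite !lee_fin => lt _.
    by rewrite absS // => /rel_imageP.
  - by move=> t mt /andP[_]; rewrite lee_fin lezD1 ltNge mt.
  - by rewrite ml.
  - by apply/Z_step; rewrite dx.
  - by [].
  - by rewrite ml.
  - by exists tau, psi; split=> //; exists m.
have kerim t (x : F t) p : d t x = 0 -> a t x \in image_power p t.
  move=> dx; elim: p => // p IHp; apply: contrapT => /negP nx.
  by apply: noF; exists t, x, p.
have [[j [y [Zy yim]]]|noI] := pselect (exists j (y : E j),
    Z y /\ y \notin image_power 1 j).
  have Ij t : in_range j%:E +oo%E t = (j <= t) by rewrite /in_range leey andbT lee_fin.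
  have [x xE] := Z_lift Zy.
  exists j%:E, +oo%E.
  have [|||||||||||tau [psi D]] := @interval_data_from j%:E +oo%E j x
      (fun t => image_power (absz (t - j)%R).+1 t) (fun t y => True).
  - by rewrite Ij.
  - by move=> t; exact: image_power_closed.
  - by move=> t u tj; rewrite Ij leNgt tj.
  - move=> t u jt _; have -> : absz (t + 1 - j)%R = (absz (t - j)%R).+1.
      apply/eqP; rewrite -eqz_nat -addn1 PoszD !gez0_abs ?subr_ge0 //.
        by rewrite addrAC.
      by rewrite (le_trans jt) // lerDl.
    apply: (@rel_image_up (image_power (absz (t - j)%R).+1)) => [s|v].
      exact: image_power_closed.
    exact: kerim.
  - move=> t u; rewrite !Ij -ltNge => tj jt1.
    have tj1 : t + 1 = j by apply/eqP; rewrite eq_le jt1 lezD1 tj.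
    rewrite [X in _ \in image_power X.+1 _](_ : _ = 0%N) ?tj1 ?subrr //.
    by apply/rel_imageP; exists u.
  - by move=> t u tj; rewrite Ij leNgt tj.
  - by move=> t jt; rewrite !Ij => jt1; rewrite (le_trans jt1) // lerDl.
  - by [].
  - by rewrite xE.
  - by rewrite Ij lerDl.
  - by rewrite subrr xE.
  - by exists tau, psi; split=> //; exists j; rewrite Ij.
have Z_down t (y : E (t + 1)) : Z y -> exists x : F t, d t x = y /\ Z (a t x).
  move=> Zy; have : y \in image_power 1 (t + 1).
    by apply: contrapT => /negP ny; apply: noI; exists (t + 1), y.
  by move=> /rel_imageP[x [dx _]]; exists x; split=> //; apply/Z_step; rewrite dx.
have [[m [x [dx xB]]]|noB] := pselect (exists m (x : F m),
    d m x = 0 /\ a m x \notin boundary m).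
  have Im t : in_range -oo%E m%:E t = (t <= m) by rewrite /in_range leNye lee_fin.
  exists -oo%E, m%:E.
  have [|||||||||||tau [psi D]] := @interval_data_from -oo%E m%:E m x boundary Z.
  - by rewrite Im.
  - by move=> t; exact: boundary_closed.
  - by move=> t u _ _; exact: boundary_step.
  - by move=> t u mt; rewrite Im lezD1 ltNge mt.
  - by move=> t u; rewrite !Im -ltNge lezD1 => mt /(lt_trans mt); rewrite ltxx.
  - by move=> t y _ _; exact: Z_down.
  - by move=> t mt; rewrite !Im lezD1 ltNge mt.
  - by apply/Z_step; rewrite dx.
  - by apply/Z_step; rewrite dx.
  - by [].
  - by [].
  - by exists tau, psi; split=> //; exists m; rewrite Im.
have It t : in_range -oo%E +oo%E t by rewrite /in_range leNye leey.
have [x xE] := Z_lift Ze.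
exists -oo%E, +oo%E.
have [|||||||||||tau [psi D]] := @interval_data_from -oo%E +oo%E i x boundary Z.
- by [].
- by move=> t; exact: boundary_closed.
- by move=> t u _ _; exact: boundary_step.
- move=> t u _ _; rewrite /boundary => /rel_imageP[y [dy /eqP ay]].
  have -> : a t u = 1 *: a t (u - y) + 0 by rewrite -ay scale1r linearB addrNK.
  apply: (boundary_closed t).2; last exact: (boundary_closed t).1.
  apply: contrapT => /negP nB; apply: noB; exists t, (u - y).
  by rewrite linearB /= dy subrr.
- by move=> t u; rewrite It.
- by move=> t y _ _; exact: Z_down.
- by [].
- by rewrite xE.
- by rewrite xE.
- by rewrite It.
- by rewrite xE.
- by exists tau, psi; split=> //; exists i.
Qed.

End LinearRelations.

Arguments boundary {k E F} a d t _.

(** * Injective representations *)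

Section InjectiveReps.
Variables (k : fieldType) (n : nat).
Implicit Types X Y : inj_cat k n.

Definition fiber X (v : 'I_n) : lmodType k := sval (X : {M : rep k n | injective_rep M}) v.

Definition ev X Y (f : hom X Y) v : fiber X v -> fiber Y v := @rhom k n _ _ f v.
Arguments ev {X Y} f v x.

HB.instance Definition _ X Y (f : hom X Y) v :=
  GRing.isLinear.Build k (fiber X v) (fiber Y v) *:%R (ev f v)
    (@rhom_linear k n _ _ f v).

Definition arr X v : fiber X v -> fiber X (ordS v) :=
  @arrow k n (sval (X : {M : rep k n | injective_rep M})) v.

HB.instance Definition _ X v :=
  GRing.isLinear.Build k (fiber X v) (fiber X (ordS v)) *:%R (@arr X v)
    (@arrow_linear k n _ v).

Lemma hom_ext X Y (f g : hom X Y) : (forall v x, ev f v x = ev g v x) -> f = g.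
Proof. exact: rep_hom_ext. Qed.

Lemma ev_comp X Y Z (g : hom Y Z) (f : hom X Y) v x :
  ev (g \oc f) v x = ev g v (ev f v x).
Proof. by []. Qed.

Lemma ev_idm X v x : ev (idm X) v x = x. Proof. by []. Qed.

Lemma ev0 X Y v x : ev (0 : hom X Y) v x = 0. Proof. by []. Qed.

Lemma evD X Y (f g : hom X Y) v x : ev (f + g) v x = ev f v x + ev g v x.
Proof. by []. Qed.

Lemma evN X Y (f : hom X Y) v x : ev (- f) v x = - ev f v x.
Proof. by []. Qed.

Lemma ev_arr X Y (f : hom X Y) v x : ev f _ (arr x) = arr (ev f v x).
Proof. exact: rhom_arrow. Qed.

Lemma arr_arr X v (x : fiber X v) : arr (arr x) = 0.
Proof. exact: arrow_arrow. Qed.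

Definition mk_hom X Y (f : forall v, {linear fiber X v -> fiber Y v})
    (fP : forall v x, f _ (arr x) = arr (f v x)) : hom X Y :=
  @RepHom k n (sval X) (sval Y) f (fun v => @linearP _ _ _ _ (f v)) fP.

Lemma ev_mk_hom X Y f fP v x : ev (@mk_hom X Y f fP) v x = f v x.
Proof. by []. Qed.

(** The cofree representation with components $X_v \times X_{v + 1}$, in which
every vector killed by the arrow is the image of the arrow. *)
Definition cofree X : rep k n.
Proof.
exists (fun v => (fiber X v * fiber X (ordS v))%type) (fun v p => (p.2, 0)) => // v c x y.
by congr pair; rewrite /= scaler0 addr0.
Defined.

(** The embedding $x |-> (x, \alpha x)$ of an injective into the cofree
representation on its components splits. *)
Lemma cofree_retraction X :
  exists r : forall v, {linear (fiber X v * fiber X (ordS v))%type -> fiber X v},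
    (forall v x, r v (x, arr x) = x) /\
    forall v p, arr (r v p) = r (ordS v) (p.2, 0).
Proof.
have el v : linear (fun x : fiber X v => (x, arr x)).
  by move=> c x y; rewrite linearP.
have ea v (x : fiber X v) : (arr x, arr (arr x)) = (arr x, 0) by rewrite arr_arr.
pose e := @RepHom k n (sval X) (cofree X) _ el ea.
have [|r re] := svalP X _ _ e (rep_id _) _; first by move=> v x y [].
have rl v : linear (rhom r (v := v) : (fiber X v * fiber X (ordS v))%type -> fiber X v).
  exact (@rhom_linear k n _ _ r v).
exists (fun v => mk_linear (rl v)); split=> v x.
  exact: (congr1 (fun f => rhom f x) re).
by rewrite /arr -rhom_arrow.
Qed.

Lemma soc_sub_rad X v (x : fiber X (ordS v)) : arr x = 0 -> exists y, arr y = x.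
Proof.
have [r [rP ra]] := cofree_retraction X.
by move=> x0; exists (r v (0, x)); rewrite ra -x0 rP.
Qed.

(** Linear maps between components are arbitrary on the socle: composing the pair
$(h x, h (\alpha x))$ with the retraction from the cofree representation makes
$h$ a morphism without changing it on the socle. *)
Lemma soc_extension X Y (h : forall v, {linear fiber X v -> fiber Y v}) :
  (forall v x, arr (h v x) = 0) ->
  exists f : hom X Y, forall v x, arr x = 0 -> ev f v x = h v x.
Proof.
move=> h0; have [r [rP ra]] := cofree_retraction Y.
have fl v : linear (fun x : fiber X v => r v (h v x, h _ (arr x))).
  by move=> c x y; rewrite -linearP; congr (r v _); rewrite !linearP.
have [f fE] : exists f : hom X Y, forall v x, ev f v x = r v (h v x, h _ (arr x)).
  unshelve eexists; first apply: (mk_hom (f := fun v => mk_linear (fl v))) => v x.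
    by rewrite /= ra arr_arr linear0.
  by [].
by exists f => v x x0; rewrite fE x0 linear0 -(h0 v x) rP.
Qed.

(** An endomorphism $f$ of an injective that fixes the socle is $1 + e$ with $e$
killing the socle. As the arrow has values in the socle, $\alpha e = e \alpha = 0$;
so $e$ has values in the socle, $e^2 = 0$, and $1 - e = 2 - f$ inverts $f$. *)
Lemma socle_unipotent X (f : hom X X) :
  (forall v x, arr x = 0 -> ev f v x = x) ->
  (idm X + idm X - f) \oc f = idm X.
Proof.
move=> fsoc; apply: hom_ext => v x.
have e0 : arr (ev f v x - x) = 0.
  by rewrite linearB /= -ev_arr fsoc ?arr_arr // subrr.
have e := fsoc v _ e0; rewrite linearB /= in e.
rewrite ev_comp !evD evN !ev_idm -addrA.
by rewrite -[ev f v x - _]opprB e opprB subrKC.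
Qed.

(** A total replacement for casts along equalities of vertices: the end of an arrow and
the vertex of the next degree are equal, but not by definition. *)
Definition move_to X u v (x : fiber X u) : fiber X v :=
  if u =P v is ReflectT e then eq_rect u (fiber X) x v e else 0.

Lemma move_to_id X u (x : fiber X u) : move_to u x = x.
Proof. by rewrite /move_to; case: eqP => // e; rewrite (eq_axiomK e). Qed.

Definition arr_to X u v (x : fiber X u) : fiber X v := move_to v (arr x).

Lemma arr_to_ordS X u (x : fiber X u) : arr_to (ordS u) x = arr x.
Proof. exact: move_to_id. Qed.

Lemma arr_to_neq X u v (x : fiber X u) : ordS u <> v -> arr_to v x = 0.
Proof. by rewrite /arr_to /move_to; case: eqP. Qed.

Fact arr_to_linear X u v : linear (@arr_to X u v).
Proof.
move=> c x y; have [<-|ne] := eqVneq (ordS u) v; first by rewrite !arr_to_ordS linearP.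
by rewrite !arr_to_neq ?scaler0 ?addr0 //; apply/eqP.
Qed.

HB.instance Definition _ X u v :=
  GRing.isLinear.Build k (fiber X u) (fiber X v) *:%R (@arr_to X u v) (@arr_to_linear X u v).

Lemma ev_arr_to X Y (f : hom X Y) u v x : ev f v (arr_to v x) = arr_to v (ev f u x).
Proof.
have [<-|/eqP ne] := eqVneq (ordS u) v; first by rewrite !arr_to_ordS ev_arr.
by rewrite !arr_to_neq // linear0.
Qed.

Lemma arr_arr_to X u v (x : fiber X u) : arr (arr_to v x) = 0.
Proof.
have [<-|/eqP ne] := eqVneq (ordS u) v; first by rewrite !arr_to_ordS arr_arr.
by rewrite !arr_to_neq // linear0.
Qed.

Lemma arr_to_eq0 X u v (x : fiber X u) : ordS u = v -> arr_to v x = 0 -> arr x = 0.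
Proof. by move=> <-; rewrite arr_to_ordS. Qed.

Lemma arr_to_surj X u v (x : fiber X v) : ordS u = v -> arr x = 0 ->
  exists y : fiber X u, arr_to v y = x.
Proof.
move=> e; case: v / e x => x /soc_sub_rad[y yx]; exists y.
by rewrite arr_to_ordS.
Qed.

End InjectiveReps.

Arguments ev {k n X Y} f v x.
Arguments arr_to {k n X u} v x.

(** * Null-homotopic chain maps and contractible complexes *)

Section Homotopies.
Variable C : addcat.
Implicit Types X Y Z : complex C.

Lemma kclass_eq0 X Y (f : chain_map X Y) : null_homotopic f -> kclass f = 0.
Proof. by move=> f0; rewrite -(kclass0 X Y); apply/kclassP; rewrite subr0. Qed.

Lemma kclass_eq0P X Y (f : chain_map X Y) : kclass f = 0 -> null_homotopic f.
Proof. by rewrite -(kclass0 X Y) => /kclassP; rewrite subr0. Qed.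

Lemma homotopy_map X Y (h : forall i j, hom (X i) (Y j)) :
  exists f : chain_map X Y, forall i,
    f i = diff Y (i - 1) i \oc h i (i - 1) + h (i + 1) i \oc diff X i (i + 1).
Proof.
pose N i := diff Y (i - 1) i \oc h i (i - 1) + h (i + 1) i \oc diff X i (i + 1).
suff NP i j : N j \oc diff X i j = diff Y i j \oc N i by exists (ChainMap NP).
have [->|ij] := eqVneq j (i + 1); last by rewrite !diff_degree // compm0 comp0m.
have e z : z = i -> diff Y z (i + 1) \oc h (i + 1) z = diff Y i (i + 1) \oc h (i + 1) i.
  by move=> ->.
rewrite /N comp_addl comp_addr e ?addrK // comp_assoc diff_diff comp0m add0r.
rewrite -[_ \oc diff X i (i + 1) in LHS]comp_assoc -comp_assoc diff_diff.
by rewrite compm0 addr0 comp_assoc.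
Qed.

End Homotopies.

Section Contractible.
Variables (k : fieldType) (n : nat).
Implicit Types X Y : complex (inj_cat k n).

(** The hypothesis says that $Hom(S, X)$ is exact for every simple module $S$.
Pseudo-inverses contract the socle subcomplex, the contraction extends to $X$, and
the null-homotopic map that results is the identity on the socle, hence invertible. *)
Lemma socle_exact_contractible X :
  (forall i v (x : fiber (X (i + 1)) v), arr x = 0 ->
     ev (diff X (i + 1) (i + 1 + 1)) v x = 0 ->
     exists y : fiber (X i) v, arr y = 0 /\ ev (diff X i (i + 1)) v y = x) ->
  kid X = 0.
Proof.
move=> exX.
have exX' i i' v (x : fiber (X i') v) : i' = i + 1 -> arr x = 0 ->
    ev (diff X i' (i' + 1)) v x = 0 ->
    exists y : fiber (X i) v, arr y = 0 /\ ev (diff X i i') v y = x.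
  by move=> ii'; subst i'; exact: exX.
have gP i j v : exists g : {linear fiber (X j) v -> fiber (X i) v},
    (forall y, arr (g y) = 0) /\
    forall x, arr x = 0 -> ev (diff X i j) v (g (ev (diff X i j) v x)) = ev (diff X i j) v x.
  have [g [ga gd]] := pseudo_inverse (ev (diff X i j) v) (ker_closed (@arr k n (X i) v)).
  exists g; split=> [y|x x0]; first exact/eqP/ga.
  by apply: gd; apply/eqP.
pose g i j v := sval (cid (gP i j v)).
have garr i j v y : arr (g i j v y) = 0 by exact: (svalP (cid (gP i j v))).1.
have gd i j v x : arr x = 0 ->
    ev (diff X i j) v (g i j v (ev (diff X i j) v x)) = ev (diff X i j) v x.
  exact: (svalP (cid (gP i j v))).2.
have hl i j v : linear (fun x => g j i v (x - g i (i + 1) v (ev (diff X i (i + 1)) v x))).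
  by move=> c x y; rewrite -linearP scalerBr addrACA -opprD !linearP.
have hP i j : exists h : hom (X i) (X j), forall v x, arr x = 0 ->
    ev h v x = g j i v (x - g i (i + 1) v (ev (diff X i (i + 1)) v x)).
  have [|h hE] := @soc_extension k n (X i) (X j) (fun v => mk_linear (hl i j v)).
    by move=> v x /=; rewrite garr.
  by exists h.
pose h i j := sval (cid (hP i j)).
have hE i j v x : arr x = 0 ->
    ev (h i j) v x = g j i v (x - g i (i + 1) v (ev (diff X i (i + 1)) v x)).
  exact: (svalP (cid (hP i j))).
have dd i j l v x : ev (diff X j l) v (ev (diff X i j) v x) = 0.
  by rewrite -ev_comp diff_diff.
have [N NE] := homotopy_map h.
have Nsoc i v x : arr x = 0 -> ev (N i) v x = x.
  move=> x0; rewrite NE evD !ev_comp !hE ?ev_arr // -?ev_arr ?x0 ?linear0 //.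
  set d := diff X i (i + 1); set y := x - _.
  have y0 : arr y = 0 by rewrite linearB /= x0 garr subrr.
  have dy : ev d v y = 0 by rewrite linearB /= gd // subrr.
  have [|z [z0 zy]] := exX' (i - 1) i v y _ y0 dy; first by rewrite subrK.
  rewrite -zy gd // zy dd linear0 subr0 /y.
  by rewrite addrNK.
have N0 : kclass N = 0 by apply: kclass_eq0; exists h.
suff -> : kid X = kclass (chain_comp (chain_id X + chain_id X - N) N).
  by rewrite -kcompE N0; exact: (@compm0 (homotopy_cat (inj_cat k n)) X X X).
congr kclass; apply: chain_map_ext => i.
by apply/esym/socle_unipotent; exact: Nsoc.
Qed.

End Contractible.

(** * Splitting off a retract *)

(** The image of an idempotent $e$, realised as the kernel of $1 - e$, is a retract
of an injective representation and therefore injective. *)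
Lemma inj_cat_split_idempotent (k : fieldType) (n : nat) (X : inj_cat k n)
    (e : hom X X) : e \oc e = e ->
  exists (Z : inj_cat k n) (i : hom Z X) (p : hom X Z),
    p \oc i = idm Z /\ i \oc p = e.
Proof.
move=> ee; have eeE v x : ev e v (ev e v x) = ev e v x by rewrite -ev_comp ee.
pose S v := subspace (ker_closed (ev (idm X - e) v)).
have SP v (x : S v) : ev e v (val x) = val x.
  have : ev (idm X - e) v (val x) = 0 by exact/eqP/(subspaceP x).
  by rewrite evD evN ev_idm => /eqP; rewrite subr_eq0 => /eqP.
have inS v (x : fiber X v) : ev e v x = x -> x \in [pred x | ev (idm X - e) v x == 0].
  by move=> ex; rewrite inE evD evN ev_idm ex subrr.
have arrS v (x : S v) : arr (val x) \in [pred x | ev (idm X - e) (ordS v) x == 0].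
  by apply: inS; rewrite ev_arr SP.
have arrl v : linear (fun x : S v =>
    in_subspace (ker_closed (ev (idm X - e) (ordS v))) (arrS v x)).
  by apply: in_subspace_linear => c x y; rewrite !linearP.
have arrarr v (x : S v) : in_subspace (ker_closed _)
    (arrS _ (in_subspace (ker_closed _) (arrS v x))) = 0.
  by apply: val_inj; rewrite /= arr_arr.
pose R := @Rep k n (fun v => S v : lmodType k) _ arrl arrarr.
pose i : rep_hom R (sval X) := @RepHom k n R (sval X) (fun v (x : S v) => val x)
  (fun v c x y => erefl) (fun v x => erefl).
have pS v (x : fiber X v) : ev e v x \in [pred x | ev (idm X - e) v x == 0].
  by apply: inS.
have pl v : linear (fun x => in_subspace (ker_closed (ev (idm X - e) v)) (pS v x)).
  by apply: in_subspace_linear => c x y; rewrite linearP.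
have pa v (x : fiber X v) : in_subspace (ker_closed _) (pS _ (arr x)) =
    arrow R (in_subspace (ker_closed _) (pS v x)).
  by apply: val_inj; rewrite /= ev_arr.
pose p : rep_hom (sval X) R := @RepHom k n (sval X) R _ pl pa.
have pi : rep_comp p i = rep_id R.
  by apply: rep_hom_ext => v x; apply: val_inj; rewrite /= SP.
have Rinj : injective_rep R.
  move=> M N f g finj; have [h hf] := svalP X M N f (rep_comp i g) finj.
  exists (rep_comp p h); apply: rep_hom_ext => v x.
  rewrite /= [rhom h _](congr1 (fun u => rhom u x) hf).
  exact: (congr1 (fun u => rhom u (rhom g x)) pi).
exists (exist _ R Rinj), i, p; split; first exact: pi.
by apply: hom_ext.
Qed.

Section Retracts.
Variable C : addcat.
Hypothesis split_idempotent : forall (X : C) (e : hom X X), e \oc e = e ->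
  exists (Z : C) (i : hom Z X) (p : hom X Z), p \oc i = idm Z /\ i \oc p = e.

Lemma complex_split_idempotent (X : complex C) (e : chain_map X X) :
  (forall j, e j \oc e j = e j) ->
  exists (Z : complex C) (i : chain_map Z X) (p : chain_map X Z),
    (forall j, p j \oc i j = idm (Z j)) /\ forall j, i j \oc p j = e j.
Proof.
move=> ee.
pose Zx j := cid (split_idempotent (ee j)); pose Z j := sval (Zx j).
pose ix j := cid (svalP (Zx j)); pose i j : hom (Z j) (X j) := sval (ix j).
pose px j := cid (svalP (ix j)); pose p j : hom (X j) (Z j) := sval (px j).
have [pi ip] : (forall j, p j \oc i j = idm (Z j)) /\ forall j, i j \oc p j = e j.
  by split=> j; have [] := svalP (px j).
pose d j l := p l \oc diff X j l \oc i j.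
have d_degree j l : l != j + 1 -> d j l = 0.
  by move=> jl; rewrite /d diff_degree // compm0 comp0m.
have id j l : i l \oc d j l = diff X j l \oc i j.
  by rewrite /d !comp_assoc ip chmP -!comp_assoc -ip -!comp_assoc pi comp_idr.
have dd j l q : d l q \oc d j l = 0.
  rewrite {1}/d -comp_assoc id !comp_assoc -(comp_assoc (p q)) diff_diff.
  by rewrite compm0 comp0m.
have iP j l : i l \oc d j l = diff X j l \oc i j by exact: id.
have pP j l : p l \oc diff X j l = d j l \oc p j.
  by rewrite /d -!comp_assoc ip -chmP comp_assoc -ip comp_assoc pi comp_idl.
by exists (Complex d_degree dd), (@ChainMap _ (Complex d_degree dd) X i iP),
  (@ChainMap _ X (Complex d_degree dd) p pP).
Qed.

(** The complement is split off as the image of $1 - f g$, which is a strict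
idempotent of complexes and so splits degreewise. *)
Lemma retract_direct_sum (X T : complex C) (f : chain_map T X) (g : chain_map X T) :
  (forall j, g j \oc f j = idm (T j)) ->
  exists Z : complex C, @is_direct_sum (homotopy_cat C) X T Z.
Proof.
move=> gf; pose e := chain_id X - chain_comp f g.
have eE j : e j = idm (X j) - f j \oc g j by [].
have ge j : g j \oc e j = 0.
  by rewrite eE comp_addr compmN comp_assoc gf comp_idl comp_idr subrr.
have ef j : e j \oc f j = 0.
  by rewrite eE comp_addl compNm -comp_assoc gf comp_idl comp_idr subrr.
have ee j : e j \oc e j = e j.
  by rewrite {1}eE comp_addl compNm -comp_assoc ge compm0 comp_idl subr0.
have [Z [i [p [pi ip]]]] := complex_split_idempotent ee.
exists Z, (kclass f), (kclass i), (kclass g), (kclass p).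
split; rewrite /= !kcompE -?kclassD.
- by congr kclass; apply: chain_map_ext.
- by congr kclass; apply: chain_map_ext.
- rewrite -kclass0; congr kclass; apply: chain_map_ext => j /=.
  by rewrite -[i j]comp_idr -pi (comp_assoc (i j)) ip comp_assoc ge comp0m.
- rewrite -kclass0; congr kclass; apply: chain_map_ext => j /=.
  by rewrite -[p j]comp_idl -pi -(comp_assoc (p j)) ip -comp_assoc ef compm0.
- congr kclass; apply: chain_map_ext => j.
  by rewrite chainDE /= ip eE subrKC.
Qed.

End Retracts.

Section Indecomposables.
Variable C : addcat.
Implicit Types X Y Z : C.

Lemma is_zero_of_isomorphic X Y : isomorphic X Y -> is_zero X -> is_zero Y.
Proof.
move=> [f [g [_ fg]]] X0.
by rewrite /is_zero -fg -[g]comp_idl X0 comp0m compm0.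
Qed.

Lemma indecomposable_isomorphic X Y :
  isomorphic X Y -> indecomposable Y -> indecomposable X.
Proof.
move=> XY [nY0 indY]; split=> [/(is_zero_of_isomorphic XY)//|Z W].
move: XY => [f [g [gf fg]]] [i1 [i2 [p1 [p2 [e11 e22 e12 e21 e]]]]].
have gfK T (h : hom T X) : g \oc (f \oc h) = h by rewrite comp_assoc gf comp_idl.
apply: indY; exists (f \oc i1), (f \oc i2), (p1 \oc g), (p2 \oc g).
split; rewrite -?comp_assoc ?gfK //.
by rewrite -comp_addr !comp_assoc -comp_addl e comp_idl.
Qed.

Lemma indecomposable_summand X Y Z :
  indecomposable X -> is_direct_sum X Y Z -> ~ is_zero Y -> isomorphic X Y.
Proof.
move=> [_ indX] XYZ nY0; have [//|Z0] := indX _ _ XYZ.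
move: XYZ => [i1 [i2 [p1 [p2 [e11 e22 e12 e21 e]]]]].
exists p1, i1; split=> //.
by rewrite -e -[p2]comp_idl Z0 comp0m compm0 addr0.
Qed.

End Indecomposables.

(** * The indecomposable injective modules *)

Section Coefficients.
Variable k : fieldType.
Implicit Type b : bool.

(** A row vector of length $b \le 1$ is determined by the sum of its entries, whichever
value $b$ has. *)
Definition coef b (x : 'rV[k]_b) : k^o := \sum_i x 0 i.

Fact coef_linear b : linear (@coef b).
Proof.
move=> c x y; rewrite /coef scaler_sumr -big_split; apply: eq_bigr => i _.
by rewrite !mxE.
Qed.

HB.instance Definition _ b :=
  GRing.isLinear.Build k 'rV[k]_b k^o *:%R (@coef b) (@coef_linear b).

Lemma coef_eq0 b (x : 'rV[k]_b) : coef x = 0 -> x = 0.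
Proof.
case: b x => x; last by rewrite [x]thinmx0.
rewrite /coef big_ord1 => x0; apply/rowP => i.
by rewrite ord1 x0 mxE.
Qed.

Lemma coef_const b c : coef (const_mx c : 'rV_b) = b%:R * c.
Proof.
rewrite /coef (eq_bigr (fun=> c)) => [|i _]; last by rewrite mxE.
by rewrite sumr_const card_ord mulr_natl.
Qed.

Lemma coef_false b (x : 'rV[k]_b) : ~~ b -> coef x = 0.
Proof. by case: b x => // x _; rewrite /coef big_ord0. Qed.

Lemma const_linear b : linear (fun c : k^o => const_mx c : 'rV[k]_b).
Proof. by move=> c x y; apply/rowP => i; rewrite !mxE. Qed.

Lemma coefK b (x : 'rV[k]_b) : coef x *: const_mx 1 = x.
Proof.
case: b x => x; last by rewrite !thinmx0.
by apply/rowP => i; rewrite !mxE /coef big_ord1 mulr1 [i]ord1.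
Qed.

Lemma coef_mul_const b b' (x : 'rV[k]_b) :
  coef (x *m const_mx 1 : 'rV_b') = b'%:R * coef x.
Proof.
rewrite -coef_const; congr coef; apply/rowP => i; rewrite !mxE.
by apply: eq_bigr => j _; rewrite mxE mulr1.
Qed.

End Coefficients.

Section IndecomposableInjective.
Variables (k : fieldType) (n : nat).
Implicit Types (M : inj_cat k n) (j v w : 'I_n) (b : bool).

Fact move_to_linear M u v : linear (@move_to k n M u v).
Proof.
move=> c x y; rewrite /move_to; case: eqP => [e|_]; last by rewrite scaler0 addr0.
by case: v / e.
Qed.

HB.instance Definition _ M u v :=
  GRing.isLinear.Build k (fiber M u) (fiber M v) *:%R (@move_to k n M u v)
    (@move_to_linear M u v).

Lemma move_to_neq M u v (x : fiber M u) : u <> v -> move_to v x = 0.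
Proof. by rewrite /move_to; case: eqP. Qed.

Local Notation I := (inj_obj k).

(** The top of $I_j$ lives at the vertex $w$ with $w + 1 = j$. It generates $I_j$
freely, since $I_j$ is also projective. *)
Definition inj_top j w : fiber (I j) w := (0, const_mx 1).

(** The coordinate on the socle, which cogenerates $I_j$ cofreely. *)
Definition inj_fun j (x : fiber (I j) j) : k^o := coef x.1.

Fact inj_fun_linear j : linear (@inj_fun j).
Proof. by move=> c x y; rewrite /inj_fun /= linearP. Qed.

Lemma inj_top_fun j w : ordS w = j -> inj_fun (arr_to j (inj_top j w)) = 1.
Proof. by move=> <-; rewrite arr_to_ordS /inj_fun /= coef_const eqxx mulr1. Qed.

Lemma inj_top_free j w M (x : fiber M w) : ordS w = j ->
  exists f : hom (I j) M, ev f w (inj_top j w) = x.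
Proof.
move=> <-.
have fl v : linear (fun y : fiber (I (ordS w)) v =>
    coef y.1 *: arr_to v x + coef y.2 *: move_to v x).
  by move=> c y z; rewrite /= !coef_linear !scalerDl scalerDr !scalerA addrACA.
unshelve eexists; first apply: (mk_hom (f := fun v => mk_linear (fl v))) => v y.
  rewrite /= linear0 scale0r addr0 [RHS](linearP (@arr k n M v)) /= arr_arr_to.
  rewrite scaler0 add0r linearZ /=.
  have [/ordS_inj vw|/eqP/coef_false->] := pselect (ordS v = ordS w); last first.
    by rewrite !scale0r.
  by subst v; rewrite arr_to_ordS move_to_id.
rewrite /= linear0 scale0r add0r coef_const eqxx mulr1 scale1r.
exact: move_to_id.
Qed.

Lemma inj_top_gen j w M (f : hom (I j) M) : ordS w = j ->
  ev f w (inj_top j w) = 0 -> f = 0.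
Proof.
move=> e; case: j / e f => f ft; apply: hom_ext => v [s t]; rewrite ev0.
have -> : (s, t) = (s, 0) + (0, t) :> fiber (I (ordS w)) v.
  by congr pair; rewrite /= ?addr0 ?add0r.
rewrite linearD /=.
have -> : ev f v (0, t) = 0.
  have [/ordS_inj e|/eqP/coef_false t0] := pselect (ordS v = ordS w); last first.
    by rewrite (coef_eq0 (t0 k t)) linear0.
  subst v; have -> : (0, t) = coef t *: inj_top (ordS w) w.
    by congr pair; rewrite /= ?scaler0 ?coefK.
  by rewrite linearZ /= ft scaler0.
rewrite addr0.
have [e|/eqP/coef_false s0] := pselect (v = ordS w); last first.
  by rewrite (coef_eq0 (s0 k s)) linear0.
subst v; have -> : (s, 0) = coef s *: arr (inj_top (ordS w) w).
  by congr pair; rewrite /= ?scaler0 ?coefK.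
by rewrite linearZ /= ev_arr ft linear0 scaler0.
Qed.

Lemma inj_fun_cofree j M (psi : {linear fiber M j -> k^o}) :
  exists f : hom M (I j), forall x, inj_fun (ev f j x) = psi x.
Proof.
have fl v : linear (fun x : fiber M v =>
    (const_mx (psi (move_to j x)), const_mx (psi (arr_to j x))) : fiber (I j) v).
  by move=> c x y; congr pair; rewrite !linearP const_linear.
unshelve eexists; first apply: (mk_hom (f := fun v => mk_linear (fl v))) => v x.
  by congr pair; rewrite /= /arr_to arr_arr !linear0; apply/rowP => i; rewrite !mxE.
by move=> x; rewrite /inj_fun ev_mk_hom /= coef_const eqxx mul1r move_to_id.
Qed.

Lemma inj_fun_faithful j v (x : fiber (I j) v) :
  inj_fun (move_to j x) = 0 -> inj_fun (arr_to j x) = 0 -> x = 0.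
Proof.
move=> x1 x2; rewrite [x]surjective_pairing; congr pair.
  have [e|/eqP/coef_false x0] := pselect (v = j); last exact/coef_eq0/x0.
  by subst v; move: x1; rewrite move_to_id => /coef_eq0.
have [e|/eqP/coef_false x0] := pselect (ordS v = j); last exact/coef_eq0/x0.
by subst j; move: x2; rewrite arr_to_ordS => /coef_eq0.
Qed.

Lemma inj_diff_top j w w' : ordS w = j -> ordS w' = w ->
  ev (inj_diff k j w : hom (I j) (I w)) w (inj_top j w) = arr_to w (inj_top w w').
Proof.
move=> <- <-; rewrite arr_to_ordS; congr pair.
apply/rowP => i; rewrite !mxE (eq_bigr (fun=> 1)) => [|? _]; last by rewrite !mxE mulr1.
by rewrite sumr_const card_ord eqxx.
Qed.

Lemma inj_diff_fun_coef j w (x : fiber (I j) w) : ordS w = j ->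
  inj_fun (ev (inj_diff k j w : hom (I j) (I w)) w x) = inj_fun (arr_to j x).
Proof.
move=> e; subst j; rewrite arr_to_ordS /inj_fun /=.
by rewrite coef_mul_const eqxx mul1r.
Qed.

End IndecomposableInjective.

(** * Truncations of the periodic complex *)

(** The terms of a truncation are either some $I_j$ or zero. The statements on $I_j$ are
transferred to terms of both kinds. *)
Section IfObj.
Variables (k : fieldType) (n : nat).
Implicit Types (M : inj_cat k n) (j v w : 'I_n) (b : bool).
Local Notation J b j := (if_obj b (inj_obj k j)).

Definition if_top b j w : fiber (J b j) w :=
  if b as b return fiber (J b j) w then inj_top k j w else 0.

Definition if_fun b j : fiber (J b j) j -> k^o :=
  if b as b return fiber (J b j) j -> k^o then @inj_fun k n j else fun=> 0.

Fact if_fun_linear b j : linear (@if_fun b j).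
Proof.
case: b => [|c x y]; first exact: inj_fun_linear.
by rewrite /= scaler0 addr0.
Qed.

HB.instance Definition _ b j :=
  GRing.isLinear.Build k (fiber (J b j) j) k^o *:%R (@if_fun b j) (@if_fun_linear b j).

Lemma zob_eq0 b j v (x : fiber (J b j) v) : ~~ b -> x = 0.
Proof. by case: b x => // x _; rewrite [x]thinmx0. Qed.

Lemma if_fun_bot b j w : ordS w = j -> b -> if_fun (arr_to j (if_top b j w)) = 1.
Proof. by case: b => // e _; exact: inj_top_fun. Qed.

Lemma if_top_free b j w M (x : fiber M w) : ordS w = j -> b ->
  exists f : hom (J b j) M, ev f w (if_top b j w) = x.
Proof. by case: b => // e _; exact: inj_top_free. Qed.

Lemma if_top_generates b j w M (f g : hom (J b j) M) : ordS w = j ->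
  ev f w (if_top b j w) = ev g w (if_top b j w) -> f = g.
Proof.
case: b f g => f g e fg; last first.
  by apply: hom_ext => v x; rewrite (@zob_eq0 false j v x) // !linear0.
apply/eqP; rewrite -subr_eq0; apply/eqP/(inj_top_gen e).
by rewrite evD evN fg subrr.
Qed.

Lemma if_fun_cofree b j M (psi : {linear fiber M j -> k^o}) : b ->
  exists f : hom M (J b j), forall x, if_fun (ev f j x) = psi x.
Proof. by case: b => // _; exact: inj_fun_cofree. Qed.

Lemma if_fun_faithful b j v (x y : fiber (J b j) v) :
  if_fun (move_to j x) = if_fun (move_to j y) ->
  if_fun (arr_to j x) = if_fun (arr_to j y) -> x = y.
Proof.
case: b x y => x y e1 e2; last by rewrite (zob_eq0 x) // (zob_eq0 y).
apply/eqP; rewrite -subr_eq0; apply/eqP/inj_fun_faithful.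
  by move: e1 => /eqP; rewrite -subr_eq0 -!linearB => /eqP.
by move: e2 => /eqP; rewrite -subr_eq0 -!linearB => /eqP.
Qed.

Lemma ev_move_to (M M' : inj_cat k n) (f : hom M M') u v (x : fiber M u) :
  ev f v (move_to v x) = move_to v (ev f u x).
Proof.
have [<-|ne] := pselect (u = v); first by rewrite !move_to_id.
by rewrite !move_to_neq // linear0.
Qed.

Lemma arr_to_socle M u v (x : fiber M u) : arr x = 0 -> arr_to v x = 0.
Proof. by move=> x0; rewrite /arr_to x0 linear0. Qed.

Lemma if_fun_ext b j M (f g : hom M (J b j)) :
  (forall x, if_fun (ev f j x) = if_fun (ev g j x)) -> f = g.
Proof.
move=> fg; apply: hom_ext => v x; apply: if_fun_faithful.
  by rewrite -!ev_move_to fg.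
by rewrite -!ev_arr_to fg.
Qed.

Lemma socle_line b j w (x : fiber (J b j) j) : ordS w = j -> arr x = 0 ->
  x = if_fun x *: arr_to j (if_top b j w).
Proof.
move=> e x0; have [bT|/negP bF] := pselect (is_true b); last first.
  by rewrite [LHS]zob_eq0 ?[RHS]zob_eq0.
apply: if_fun_faithful; first by rewrite !move_to_id linearZ /= if_fun_bot // [RHS]mulr1.
have z0 : arr (if_fun x *: arr_to j (if_top b j w)) = 0.
  by rewrite linearZ /= arr_arr_to scaler0.
by rewrite (arr_to_socle _ x0) (arr_to_socle _ z0).
Qed.

(** The socle has dimension at most one, so that an endomorphism acts on it by a
scalar. *)
Lemma socle_scalar b j w (f : hom (J b j) (J b j)) v (x : fiber (J b j) v) :
  ordS w = j -> arr x = 0 ->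
  ev f v x = if_fun (ev f j (arr_to j (if_top b j w))) *: x.
Proof.
move=> e x0; apply: if_fun_faithful; last first.
  have f0 : arr (ev f v x) = 0 by rewrite -ev_arr x0 linear0.
  have c0 c : arr (c *: x) = 0 by rewrite linearZ /= x0 scaler0.
  by rewrite (arr_to_socle _ f0) (arr_to_socle _ (c0 _)).
rewrite -ev_move_to linearZ /=.
have : arr (move_to j x) = 0.
  have [vj|ne] := pselect (v = j); last by rewrite move_to_neq // linear0.
  by subst v; rewrite move_to_id.
move=> /(socle_line e) {1}->; rewrite linearZ linearZ /= linearZ /=.
by rewrite [LHS]mulrC.
Qed.

End IfObj.

Section IfHom.
Variables (k : fieldType) (n : nat).
Implicit Types (j v w : 'I_n) (b : bool).
Local Notation inj_hom j w := (inj_diff k j w : hom (inj_obj k j) (inj_obj k w)).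

Lemma if_hom_top b b' j w w' : b -> b' -> ordS w = j -> ordS w' = w ->
  ev (if_hom b b' (inj_hom j w)) w (if_top k b j w) = arr_to w (if_top k b' w w').
Proof. by case: b; case: b' => // _ _; exact: inj_diff_top. Qed.

Lemma if_hom_fun b b' j w (x : fiber (if_obj b (inj_obj k j)) w) :
  b -> b' -> ordS w = j ->
  if_fun (ev (if_hom b b' (inj_hom j w)) w x) = if_fun (arr_to j x).
Proof. by case: b x; case: b' => // x _ _; exact: inj_diff_fun_coef. Qed.

End IfHom.

Section StringComplex.
Variables (k : fieldType) (n : nat) (n_gt0 : (0 < n)%N).
Implicit Types (p i : int) (l m : \bar int).
Implicit Types X : complex (inj_cat k n).

Definition string_cpx l m p : complex (inj_cat k n) :=
  shift p (trunc l m (periodic_complex k n_gt0)).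

(** The vertex of the socle in degree $i$. The top in degree $i$ lies at the vertex of
degree $i + 1$, in accordance with the differential mapping it to the next socle. *)
Definition string_vertex p i : 'I_n := vertex n_gt0 (1 - (i + p)).

Lemma string_vertexS p i : ordS (string_vertex p (i + 1)) = string_vertex p i.
Proof. by rewrite /string_vertex -vertexS [i + 1 + p]addrAC opprD addrA subrK. Qed.

Definition shift_sign p : k := (-1) ^+ odd `|p|.

Lemma shift_signK p : shift_sign p * shift_sign p = 1.
Proof. by rewrite /shift_sign -signr_addb addbb. Qed.

Definition string_top l m p i : fiber (string_cpx l m p i) (string_vertex p (i + 1)) :=
  if_top k (in_range l m (i + p)) (string_vertex p i) (string_vertex p (i + 1)).

Definition string_coord l m p i : fiber (string_cpx l m p i) (string_vertex p i) -> k^o :=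
  @if_fun k n (in_range l m (i + p)) (string_vertex p i).

HB.instance Definition _ l m p i :=
  GRing.isLinear.Build k _ k^o *:%R (@string_coord l m p i)
    (@if_fun_linear k n (in_range l m (i + p)) (string_vertex p i)).

Lemma ev_if_hom b b' (Y Z : inj_cat k n) (f : hom Y Z) v (x : fiber (if_obj b Y) v) :
  ~~ (b && b') -> ev (if_hom b b' f) v x = 0.
Proof. by case: b x; case: b'. Qed.

Lemma string_diffE l m p i v x :
  ev (diff (string_cpx l m p) i (i + 1)) v x =
  shift_sign p *: ev (if_hom (in_range l m (i + p)) (in_range l m (i + 1 + p))
    (inj_diff k (string_vertex p i) (string_vertex p (i + 1)) :
       hom (inj_obj k (string_vertex p i)) (inj_obj k (string_vertex p (i + 1))))) v x.
Proof.
have e : i + 1 + p == i + p + 1 by rewrite addrAC.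
rewrite /shift_sign /= /shift_diff /= /trunc_diff /= /periodic_diff e.
by case: (odd _); rewrite /= ?evN ?expr1 ?scaleN1r ?scale1r.
Qed.

Lemma string_diff_out l m p i v x :
  ~~ (in_range l m (i + p) && in_range l m (i + 1 + p)) ->
  ev (diff (string_cpx l m p) i (i + 1)) v x = 0.
Proof. by move=> out; rewrite string_diffE ev_if_hom // scaler0. Qed.

Lemma string_diff_top l m p i : in_range l m (i + p) -> in_range l m (i + 1 + p) ->
  ev (diff (string_cpx l m p) i (i + 1)) _ (string_top l m p i) =
  shift_sign p *: arr_to (string_vertex p (i + 1)) (string_top l m p (i + 1)).
Proof.
move=> i0 i1; rewrite string_diffE; congr (_ *: _).
by apply: if_hom_top => //; exact: string_vertexS.
Qed.

Lemma string_diff_coord l m p i (x : fiber (string_cpx l m p i) (string_vertex p (i + 1))) :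
  in_range l m (i + p) -> in_range l m (i + 1 + p) ->
  string_coord (ev (diff (string_cpx l m p) i (i + 1)) _ x) =
  shift_sign p * string_coord (arr_to (string_vertex p i) x).
Proof.
move=> i0 i1; rewrite string_diffE /string_coord linearZ; congr (_ * _).
by apply: if_hom_fun => //; exact: string_vertexS.
Qed.

(** Maps out of a truncation are free on the tops: they are the sequences of elements
that satisfy the relation $d t_i = \pm \alpha t_{i + 1}$ of the tops. *)
Lemma string_map_of_elements l m p X
    (tau : forall i, fiber (X i) (string_vertex p (i + 1))) :
  (forall i, in_range l m (i + p) -> in_range l m (i + 1 + p) ->
     shift_sign p *: ev (diff X i (i + 1)) _ (tau i) = arr_to _ (tau (i + 1))) ->
  (forall i, in_range l m (i + p) -> ~~ in_range l m (i + 1 + p) ->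
     shift_sign p *: ev (diff X i (i + 1)) _ (tau i) = 0) ->
  exists f : chain_map (string_cpx l m p) X,
    forall i, in_range l m (i + p) -> ev (f i) _ (string_top l m p i) = tau i.
Proof.
move=> step last.
have fP i : exists f : hom (string_cpx l m p i) (X i),
    in_range l m (i + p) -> ev f _ (string_top l m p i) = tau i.
  have [Ii|nIi] := pselect (is_true (in_range l m (i + p))); last by exists 0.
  have [f fE] := if_top_free (tau i) (string_vertexS p i) Ii.
  by exists f.
pose f i := sval (cid (fP i)).
have fE i : in_range l m (i + p) -> ev (f i) _ (string_top l m p i) = tau i.
  exact: (svalP (cid (fP i))).
suff chmP i j : f j \oc diff (string_cpx l m p) i j = diff X i j \oc f i.
  by exists (ChainMap chmP).
have [->|ij] := eqVneq j (i + 1); last by rewrite !diff_degree // comp0m compm0.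
apply: (if_top_generates (string_vertexS p i)); rewrite -/(string_top l m p i) !ev_comp.
have [Ii|/negP nIi] := pselect (is_true (in_range l m (i + p))); last first.
  by rewrite /string_top (zob_eq0 (if_top _ _ _ _)) // !linear0.
rewrite fE //.
have [Ii1|/negP nIi1] := pselect (is_true (in_range l m (i + 1 + p))); last first.
  rewrite string_diff_out ?(negPf nIi1) ?andbF // linear0.
  have := congr1 ( *:%R (shift_sign p)) (last i Ii nIi1).
  by rewrite scaler0 scalerA shift_signK scale1r.
rewrite string_diff_top // linearZ /= ev_arr_to fE // -step //.
by rewrite scalerA shift_signK scale1r.
Qed.

(** Dually, maps into a truncation are determined by their coordinates on the socles. *)
Lemma string_map_of_functionals l m p X
    (psi : forall i, {linear fiber (X i) (string_vertex p i) -> k^o}) :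
  (forall i, in_range l m (i + p) -> in_range l m (i + 1 + p) -> forall x,
     psi (i + 1) (shift_sign p *: ev (diff X i (i + 1)) _ x) = psi i (arr_to _ x)) ->
  (forall i, ~~ in_range l m (i + p) -> in_range l m (i + 1 + p) -> forall x,
     psi (i + 1) (shift_sign p *: ev (diff X i (i + 1)) _ x) = 0) ->
  exists g : chain_map X (string_cpx l m p),
    forall i, in_range l m (i + p) -> forall x, string_coord (ev (g i) _ x) = psi i x.
Proof.
move=> step first.
have gP i : exists g : hom (X i) (string_cpx l m p i),
    in_range l m (i + p) -> forall x, string_coord (ev g _ x) = psi i x.
  have [Ii|nIi] := pselect (is_true (in_range l m (i + p))); last by exists 0.
  have [g gE] := if_fun_cofree (psi i) Ii.
  by exists g.
pose g i := sval (cid (gP i)).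
have gE i : in_range l m (i + p) -> forall x, string_coord (ev (g i) _ x) = psi i x.
  exact: (svalP (cid (gP i))).
suff chmP i j : g j \oc diff X i j = diff (string_cpx l m p) i j \oc g i.
  by exists (ChainMap chmP).
have [->|ij] := eqVneq j (i + 1); last by rewrite !diff_degree // comp0m compm0.
apply: if_fun_ext => x; rewrite !ev_comp.
have [Ii1|/negP nIi1] := pselect (is_true (in_range l m (i + 1 + p))); last first.
  by congr if_fun; rewrite [LHS]zob_eq0 // [RHS]zob_eq0.
have eps y : psi (i + 1) y = shift_sign p * psi (i + 1) (shift_sign p *: y).
  by rewrite linearZ /= [RHS]mulrA shift_signK mul1r.
rewrite -!/(string_coord _) gE // eps.
have [Ii|/negP nIi] := pselect (is_true (in_range l m (i + p))); last first.
  by rewrite first // mulr0 string_diff_out ?(negPf nIi) // linear0.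
by rewrite step // string_diff_coord // -ev_arr_to gE.
Qed.

Lemma string_coord_bot l m p i : in_range l m (i + p) ->
  string_coord (arr_to (string_vertex p i) (string_top l m p i)) = 1.
Proof. by move=> Ii; apply: if_fun_bot => //; exact: string_vertexS. Qed.

Lemma string_socle_scalar l m p i (f : hom (string_cpx l m p i) (string_cpx l m p i)) v x :
  arr x = 0 -> ev f v x = string_coord (ev f _ (arr_to _ (string_top l m p i))) *: x.
Proof. by move=> x0; apply: socle_scalar => //; exact: string_vertexS. Qed.

End StringComplex.

(** * Interval summands and the classification *)

(** Truncation applies to the unshifted degree, intervals are found in the shifted
one. *)
Lemma in_range_shift (l m : \bar int) (p : int) :
  exists l' m', forall i, in_range l' m' (i + p) = in_range l m i.
Proof.
pose s (x : \bar int) := if x is y%:E then (y + p)%:E else x.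
exists (s l), (s m) => i; rewrite /in_range.
by case: l => [l||]; case: m => [m||]; rewrite /= ?lee_fin ?lerD2r ?leey ?leNye.
Qed.

Lemma in_range_exists (l m : \bar int) :
  (exists i : int, in_range l m i) <-> [/\ l != +oo%E, m != -oo%E & (l <= m)%E].
Proof.
split=> [[i /andP[li im]]|[]].
  by split; [case: l li|case: m im|exact: le_trans im].
case: l => [l||] //; case: m => [m||] // _ _ lm.
- by exists l; rewrite /in_range lexx.
- by exists l; rewrite /in_range lexx leey.
- by exists m; rewrite /in_range lexx leNye.
- by exists 0; rewrite /in_range leNye leey.
Qed.

Section Classification.
Variables (k : fieldType) (n : nat) (n_gt0 : (0 < n)%N).
Implicit Types X : complex (inj_cat k n).
Local Notation T := (string_cpx k n_gt0).

(** The composite $g f$ acts as the identity on the one-dimensional socles, so it is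
unipotent and $g$ can be corrected to a strict retraction. *)
Lemma string_retract l m p X (f : chain_map (T l m p) X) (g : chain_map X (T l m p)) :
  (forall i, in_range l m (i + p) ->
     string_coord (ev (g i) _ (ev (f i) _ (arr_to _ (string_top k n_gt0 l m p i)))) = 1) ->
  exists g' : chain_map X (T l m p), forall i, g' i \oc f i = idm (T l m p i).
Proof.
move=> gf1; pose e := chain_comp g f.
exists (chain_comp (chain_id _ + chain_id _ - e) g) => i.
apply: etrans (esym (comp_assoc _ _ _)) _.
apply: (@socle_unipotent _ _ (T l m p i) (e i)) => v x x0.
have [Ii|/negP nIi] := pselect (is_true (in_range l m (i + p))).
  by rewrite string_socle_scalar // ev_comp gf1 // scale1r.
by rewrite (zob_eq0 x nIi) linear0.
Qed.

Lemma vertex_surj v : exists z, vertex n_gt0 z = v.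
Proof.
exists v%:Z; apply: val_inj => /=.
by rewrite modz_small ?absz_nat // lez_nat ltz_nat /=.
Qed.

(** If every socle cycle of $X$ bounds in the socle then $X$ is contractible. A cycle
that does not bound lies on one of the diagonals of $X$, and the interval that it yields there
is the truncation sought. The sign of the shift is absorbed in the map $d$ of
the diagonal. *)
Lemma string_summand X : kid X <> 0 ->
  exists l m p, (exists i, in_range l m i) /\
    exists (f : chain_map (T l m p) X) (g : chain_map X (T l m p)),
      forall i, g i \oc f i = idm (T l m p i).
Proof.
move=> nX0.
have [i [v [x [x0 dx0 nx]]]] : exists (i : int) v (x : fiber (X (i + 1)) v),
    [/\ arr x = 0, ev (diff X (i + 1) (i + 1 + 1)) v x = 0
      & ~ exists y : fiber (X i) v, arr y = 0 /\ ev (diff X i (i + 1)) v y = x].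
  apply: contrapT => nex; apply/nX0/socle_exact_contractible => i v x x0 dx0.
  by apply: contrapT => ny; apply: nex; exists i, v, x.
have [p pv] : exists p, string_vertex n_gt0 p (i + 1) = v.
  have [z <-] := vertex_surj v; exists (- i - z).
  by rewrite /string_vertex addrAC addrA subrr sub0r opprD opprK addrCA subrr addr0.
subst v.
pose E t := fiber (X t) (string_vertex n_gt0 p t).
pose F t := fiber (X t) (string_vertex n_gt0 p (t + 1)).
pose a t : {linear F t -> E t} := mk_linear (@arr_to_linear k n (X t)
  (string_vertex n_gt0 p (t + 1)) (string_vertex n_gt0 p t)).
pose eps := shift_sign k p.
have dl t : linear (fun x : F t => eps *: ev (diff X t (t + 1)) _ x : E (t + 1)).
  by move=> c y z; rewrite linearP scalerDr !scalerA mulrC.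
pose d t : {linear F t -> E (t + 1)} := mk_linear (dl t).
pose Z t (e : E t) := arr e = 0 /\ ev (diff X t (t + 1)) _ e = 0.
have dd t j u w y : ev (diff X j u) w (ev (diff X t j) w y) = 0.
  by rewrite -ev_comp diff_diff.
have eps0 t w (y : fiber (X t) w) : eps *: y = 0 -> y = 0.
  by move=> /(congr1 ( *:%R eps)); rewrite scalerA shift_signK scale1r scaler0.
have Z_lift t (e : E t) : Z t e -> exists y, a t y = e.
  by move=> [e0 _]; apply: arr_to_surj => //; exact: string_vertexS.
have Z_step t (y : F t) : Z (t + 1) (d t y) <-> Z t (a t y).
  split=> [[ady _]|[_ day]]; split.
  - exact: arr_arr_to.
  - rewrite /= ev_arr_to; move: ady; rewrite /= linearZ /= => /eps0 ady.
    by rewrite /arr_to ady linear0.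
  - rewrite /= linearZ /=; move: day; rewrite /= ev_arr_to => /arr_to_eq0->.
      by rewrite scaler0.
    exact: string_vertexS.
  - by rewrite /= linearZ /= dd scaler0.
have Z0 t : Z t 0 by rewrite /Z !linear0.
have ker_lift t (y : F t) : a t y = 0 ->
    exists z : F (t + 1), a (t + 1) z = d t y /\ d (t + 1) z = 0.
  move=> /arr_to_eq0 ay.
  have [z zy] := arr_to_surj (string_vertexS n_gt0 p (t + 1)) (ay (string_vertexS n_gt0 p t)).
  exists (eps *: ev (diff X t (t + 1)) _ z).
  by rewrite /= !linearZ /= -ev_arr_to zy dd !scaler0.
have xB : (x : E (i + 1)) \notin boundary a d (i + 1).
  apply/negP => /rel_imageP[y [dy /eqP ay]]; apply: nx.
  exists (eps *: y); rewrite !linearZ; split=> //.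
  by rewrite /= (arr_to_eq0 _ ay) ?scaler0 //; exact: string_vertexS.
have [l [m [tau [psi [[j Ij] D]]]]] :=
  interval_data_exists Z_lift Z_step Z0 ker_lift (conj x0 dx0 : Z (i + 1) x) xB.
have [l' [m' lmE]] := in_range_shift l m p.
have [||f fE] := @string_map_of_elements k n n_gt0 l' m' p X tau.
- by move=> t; rewrite !lmE; exact: (data_step D).
- by move=> t; rewrite !lmE; exact: (data_top D).
have [||g gE] := @string_map_of_functionals k n n_gt0 l' m' p X psi.
- by move=> t; rewrite !lmE; exact: (data_dual_step D).
- by move=> t; rewrite !lmE; exact: (data_dual_bottom D).
exists l', m', p; split; first by exists (j + p); rewrite lmE.
have [|g' g'f] := @string_retract l' m' p X f g; last by exists f, g'.
move=> t It; rewrite ev_arr_to fE // gE //.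
by apply: (data_unit D); rewrite -lmE.
Qed.

End Classification.

Lemma retract_idempotent (C : addcat) (X Y : C) (i : hom Y X) (p : hom X Y) :
  p \oc i = idm Y -> (i \oc p) \oc (i \oc p) = i \oc p.
Proof. by move=> pi; rewrite -comp_assoc (comp_assoc p) pi comp_idl. Qed.

Section StringIndecomposable.
Variables (k : fieldType) (n : nat) (n_gt0 : (0 < n)%N).
Implicit Types X : complex (inj_cat k n).
Local Notation T := (string_cpx k n_gt0).

(** Truncations are minimal: the differential kills the socles. *)
Lemma string_diff_socle l m p i j v (x : fiber (T l m p i) v) : arr x = 0 ->
  ev (diff (T l m p) i j) v x = 0.
Proof.
move=> x0; have [->|ij] := eqVneq j (i + 1); last by rewrite diff_degree.
have [Ii|/negP nIi] := pselect (is_true (in_range l m (i + p))); last first.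
  by rewrite (zob_eq0 x nIi) linear0.
have [Ii1|/negP nIi1] := pselect (is_true (in_range l m (i + 1 + p))); last first.
  exact: zob_eq0.
apply: (@if_fun_faithful _ _ _ (string_vertex n_gt0 p (i + 1))); last first.
  by rewrite -ev_arr_to (arr_to_socle _ x0) !linear0.
rewrite -ev_move_to -/(string_coord _) string_diff_coord // [in RHS]/= !linear0.
suff x1 : arr (move_to (string_vertex n_gt0 p (i + 1)) x) = 0.
  by rewrite (arr_to_socle _ x1) linear0 mulr0.
have [e|ne] := pselect (v = string_vertex n_gt0 p (i + 1)).
  by subst v; rewrite move_to_id.
by rewrite move_to_neq // linear0.
Qed.

(** Both terms of $d h + h d$ apply the differential to a socle. *)
Lemma string_null_homotopic_socle l m p (f : chain_map (T l m p) (T l m p)) :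
  null_homotopic f -> forall i v (x : fiber (T l m p i) v), arr x = 0 -> ev (f i) v x = 0.
Proof.
move=> [h hP] i v x x0; rewrite hP evD !ev_comp (string_diff_socle _ x0).
rewrite linear0 addr0.
by rewrite string_diff_socle // -ev_arr x0 linear0.
Qed.

(** The scalars in consecutive degrees agree because the differential maps the top in
degree $i$ to the socle in degree $i + 1$. *)
Lemma string_endo_scalar l m p (f : chain_map (T l m p) (T l m p)) :
  exists c, forall i v (x : fiber (T l m p i) v), arr x = 0 -> ev (f i) v x = c *: x.
Proof.
pose c i := string_coord (ev (f i) _ (arr_to _ (string_top k n_gt0 l m p i))).
have cS i : in_range l m (i + p) -> in_range l m (i + 1 + p) -> c i = c (i + 1).
  move=> Ii Ii1; pose t := string_top k n_gt0 l m p i.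
  have e : ev (f (i + 1)) _ (ev (diff (T l m p) i (i + 1)) _ t) =
      ev (diff (T l m p) i (i + 1)) _ (ev (f i) _ t).
    by rewrite -!ev_comp chmP.
  move/(congr1 (@string_coord k n n_gt0 l m p (i + 1))): e.
  rewrite string_diff_top // string_diff_coord // linearZ linearZ /=.
  move=> /(congr1 ( *%R (shift_sign k p))); rewrite !mulrA shift_signK !mul1r => e.
  by rewrite /c e ev_arr_to.
have [l' [m' lmE]] := in_range_shift l m (- p).
have {}lmE t : in_range l' m' t = in_range l m (t + p) by rewrite -lmE addrK.
have [[i0 Ii0]|none] := pselect (exists i0, is_true (in_range l m (i0 + p))).
  exists (c i0) => i v x x0.
  have [Ii|/negP nIi] := pselect (is_true (in_range l m (i + p))).
    rewrite string_socle_scalar // -/(c i) (@in_range_constant _ c l' m' _ i i0) ?lmE //.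
    by move=> t; rewrite !lmE; exact: cS.
  by rewrite (zob_eq0 x nIi) linear0 scaler0.
exists 0 => i v x _; rewrite (zob_eq0 x) ?linear0 ?scaler0 //.
by apply/negP => Ii; apply: none; exists i.
Qed.

Definition string_obj l m p : KInj k n := T l m p.

Lemma string_not_zero l m p : (exists i, in_range l m i) -> ~ is_zero (string_obj l m p).
Proof.
move=> [i Ii] /kclass_eq0P/string_null_homotopic_socle id0.
have Ii' : in_range l m (i - p + p) by rewrite subrK.
have := string_coord_bot k n_gt0 Ii'.
rewrite -[arr_to _ _]ev_idm id0 ?arr_arr_to // linear0 => /esym/eqP.
by rewrite oner_eq0.
Qed.

(** A map that kills the socles has square zero, already before passing to homotopy
classes. *)
Lemma string_idempotent_eq0 l m p (f : chain_map (T l m p) (T l m p)) :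
  kcomp (kclass f) (kclass f) = kclass f ->
  (forall i v (x : fiber (T l m p i) v), arr x = 0 -> ev (f i) v x = 0) ->
  kclass f = 0.
Proof.
move=> <- f0; rewrite kcompE -kclass0; congr kclass; apply: chain_map_ext => i.
by apply: hom_ext => v x; rewrite ev_comp f0 // -ev_arr f0 // arr_arr.
Qed.

(** Complementary orthogonal idempotents act on the socle by scalars $c_1$, $c_2$ with
$c_1 c_2 = 0$, because null-homotopic maps act by zero; the one that acts by zero
vanishes. *)
Lemma string_indecomposable l m p : (exists i, in_range l m i) ->
  indecomposable (string_obj l m p).
Proof.
move=> lm; split; first exact: string_not_zero.
move=> Y Z [i1 [i2 [p1 [p2 [e11 e22 e12 e21 e]]]]].
have [i Ii] := lm.
have Ii' : in_range l m (i - p + p) by rewrite subrK.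
pose s := arr_to (string_vertex n_gt0 p (i - p)) (string_top k n_gt0 l m p (i - p)).
have s0 (c : chain_map (T l m p) (T l m p)) :
    null_homotopic c -> ev (c (i - p)) _ s = 0.
  by move=> c0; rewrite (string_null_homotopic_socle c0) // arr_arr_to.
have s_neq0 (c : k) : c *: s = 0 -> c = 0.
  move=> /(congr1 (@string_coord k n n_gt0 l m p (i - p))).
  by rewrite linearZ /= string_coord_bot // linear0 [_ *: _]mulr1.
pose f1 := krepr (i1 \oc p1); pose f2 := krepr (i2 \oc p2).
have [c1 c1P] := string_endo_scalar f1; have [c2 c2P] := string_endo_scalar f2.
have k1 : kclass f1 = i1 \oc p1 by exact: kreprK.
have k2 : kclass f2 = i2 \oc p2 by exact: kreprK.
have id1 : kcomp (kclass f1) (kclass f1) = kclass f1.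
  by rewrite k1; exact: (retract_idempotent e11).
have id2 : kcomp (kclass f2) (kclass f2) = kclass f2.
  by rewrite k2; exact: (retract_idempotent e22).
have c12 : c1 * c2 = 0.
  apply: s_neq0; rewrite -scalerA -c2P ?arr_arr_to // -c1P; last first.
    by rewrite -ev_arr arr_arr_to linear0.
  rewrite -ev_comp; apply: (s0 (chain_comp f1 f2)).
  apply: kclass_eq0P; rewrite -kcompE k1 k2.
  suff : (i1 \oc p1) \oc (i2 \oc p2) = 0 by [].
  by rewrite -comp_assoc (comp_assoc p1) e12 comp0m compm0.
have zero_of (W : KInj k n) (j : hom W (string_obj l m p)) (q : hom (string_obj l m p) W) :
    q \oc j = idm W -> j \oc q = 0 -> is_zero W.
  move=> qj jq; rewrite /is_zero -[idm W]comp_idl -qj -comp_assoc (comp_assoc j).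
  by rewrite jq comp0m compm0.
have [c10|c20] : c1 = 0 \/ c2 = 0.
  by have /eqP := c12; rewrite mulf_eq0 => /orP[/eqP|/eqP]; [left | right].
- left; apply: (zero_of _ _ _ e11); rewrite -k1; apply: string_idempotent_eq0 id1 _.
  by move=> j v x x0; rewrite c1P // c10 scale0r.
- right; apply: (zero_of _ _ _ e22); rewrite -k2; apply: string_idempotent_eq0 id2 _.
  by move=> j v x x0; rewrite c2P // c20 scale0r.
Qed.

Lemma indecomposable_string (X : KInj k n) : indecomposable X ->
  exists l m p, (exists i, in_range l m i) /\ isomorphic X (string_obj l m p).
Proof.
move=> indX; have [l [m [p [lm [f [g gf]]]]]] := string_summand n_gt0 indX.1.
exists l, m, p; split=> //.
have [Z XTZ] := retract_direct_sum (@inj_cat_split_idempotent k n) gf.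
exact: indecomposable_summand indX XTZ (string_not_zero lm).
Qed.

End StringIndecomposable.

(** * Modules of finite length *)

Section FiniteLength.
Variables (k : fieldType) (R : pzRingType) (V : lmodType R).
Implicit Types (M : nat -> {pred V}) (N : {pred V}) (r : nat).

Definition strict_chain (M : nat -> {pred V}) r :=
  [/\ forall i, GRing.submod_closed (M i), M 0%N =i pred1 0, M r =i predT
    & forall i, (i < r)%N -> {subset M i <= M i.+1} /\ ~ {subset M i.+1 <= M i}].

(** A strict chain of maximal length cannot be refined. *)
Lemma finite_length_bounded b :
  (forall M r, strict_chain M r -> (r <= b)%N) -> finite_length V.
Proof.
move=> bound.
pose P r := `[< exists M, strict_chain M r >].
have Pex : exists r, P r.
  have [V0|nV0] := pselect (forall x : V, x = 0).
    exists 0%N; apply/asboolP; exists (fun=> predT : {pred V}); split=> // [x].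
    by rewrite !inE (V0 x) eqxx.
  exists 1%N; apply/asboolP.
  exists (fun i => if i is 0%N then (pred1 0 : {pred V}) else predT).
  split=> // [[|i]|[|//] _]; split=> //; first by rewrite inE.
    by move=> c x y; rewrite !inE => /eqP-> /eqP->; rewrite scaler0 addr0.
  by move=> sub; apply: nV0 => x; apply/eqP/sub.
have Pb r : P r -> (r <= b)%N by move=> /asboolP[M /bound].
case: (ex_maxnP Pex Pb) => r /asboolP[M [Mcl M0 Mr Mlt]] rmax.
exists r, M; split=> // i ir; have [Mi nMi] := Mlt _ ir; split=> // N Ncl MN NM.
apply: contrapT => /not_orP[nN1 nN2].
have NMi : ~ {subset N <= M i}.
  by move=> sub; apply: nN1 => x; apply/idP/idP; [exact: sub | exact: MN].
have MiN : ~ {subset M i.+1 <= N}.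
  by move=> sub; apply: nN2 => x; apply/idP/idP; [exact: NM | exact: sub].
suff : P r.+1 by move=> /rmax; rewrite ltnn.
apply/asboolP.
exists (fun t => if (t <= i)%N then M t else if t == i.+1 then N else M t.-1).
split.
- by move=> t; case: ifP => // _; case: ifP.
- by [].
- by rewrite ltnNge ltnW //= eqSS gtn_eqF.
- move=> t; rewrite ltnS => move_to; have [ti|it|->] := ltngtP t i.
  + exact: Mlt (ltn_trans ti ir).
  + rewrite eqSS (gtn_eqF it) /=.
    have [->|nt] := eqVneq t i.+1.
      by split; [exact: NM | exact: MiN].
    have t0 : (0 < t)%N by exact: leq_ltn_trans it.
    by rewrite -{2 3}(prednK t0); apply: Mlt; rewrite prednK.
  + by rewrite eqxx.
Qed.

Variables (kappa : k -> R) (d : nat) (g : 'I_d -> V).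
Hypothesis kappaD : {morph kappa : a b / a + b}.
Hypothesis kappaM : {morph kappa : a b / a * b}.
Hypothesis kappa1 : kappa 1 = 1.
Hypothesis spanned : forall x, exists c : 'I_d -> k, x = \sum_i kappa (c i) *: g i.

(** Vectors $v_i$, one in each step of a chain longer than the number of generators,
satisfy a linear relation over $k$; its last term contradicts strictness. *)
Lemma strict_chain_bounded M r : strict_chain M r -> (r <= d)%N.
Proof.
move=> [Mcl _ _ Mlt]; rewrite leqNgt; apply/negP => dr.
have Mle i j : (i <= j)%N -> (j <= r)%N -> {subset M i <= M j}.
  elim: j => [|j IHj]; first by rewrite leqn0 => /eqP-> _ x.
  rewrite leq_eqVlt => /orP[/eqP-> _ x //|ij] jr x Mx.
  by apply: (Mlt _ jr).1; apply: IHj Mx => //; exact: ltnW.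
have kappa0 : kappa 0 = 0 by apply: (addrI (kappa 0)); rewrite -kappaD !addr0.
have kappa_sum (I : finType) (F : I -> k) : kappa (\sum_i F i) = \sum_i kappa (F i).
  exact: (big_morph kappa kappaD kappa0).
have vP (i : 'I_r) : exists x, x \in M i.+1 /\ x \notin M i.
  have [_ nsub] := Mlt i (ltn_ord i).
  apply: contrapT => nex; apply: nsub => x Mx; apply: contrapT => /negP nMx.
  by apply: nex; exists x.
pose v i := sval (cid (vP i)); pose vM i := svalP (cid (vP i)).
pose c i := sval (cid (spanned (v i))); pose cE i := svalP (cid (spanned (v i))).
pose A : 'M[k]_(r, d) := \matrix_(i, j) c i j.
have : kermx A != 0.
  rewrite kermx_eq0 /row_free neq_ltn (leq_ltn_trans (rank_leq_col A) dr) //.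
case/rowV0Pn => u /sub_kermxP uA u0.
have uv : \sum_i kappa (u 0 i) *: v i = 0.
  under eq_bigr => i _ do rewrite [v i](cE i) scaler_sumr.
  rewrite exchange_big big1 // => j _.
  under eq_bigr => i _ do rewrite scalerA -kappaM.
  rewrite -scaler_suml -kappa_sum.
  have := congr1 (fun B : 'rV_d => B 0 j) uA; rewrite !mxE.
  under eq_bigr => i _ do rewrite mxE.
  by rewrite -/(c _) => ->; rewrite kappa0 scale0r.
have /rV0Pn[i0 ui0] := u0.
case: (@arg_maxnP _ i0 (fun i => u 0 i != 0) (fun i => i : nat) ui0) => i ui imax.
have [vi nvi] := vM i; move/negP: nvi; apply.
have [Mi0 MiP] := Mcl i.
have : kappa (u 0 i) *: v i \in M i.
  move: uv; rewrite (bigD1 i) //= => /eqP; rewrite addr_eq0 => /eqP->.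
  rewrite -scaleN1r -[_ *: _]addr0; apply: (MiP) => //.
  apply: (big_ind (fun x => x \in M i)) => // [x y Mx My|j ji].
    by rewrite -[x]scale1r; exact: MiP.
  have [->|uj] := eqVneq (u 0 j) 0; first by rewrite kappa0 scale0r.
  have lji : (j < i)%N by rewrite ltn_neqAle ji; exact: imax.
  rewrite -[_ *: _]addr0; apply: MiP => //; apply: Mle (vM j).1 => //.
  exact: ltnW.
move=> /(MiP (kappa (u 0 i)^-1) _ 0) /(_ Mi0).
by rewrite addr0 scalerA -kappaM mulVf // kappa1 scale1r.
Qed.

Lemma finite_length_spanned : finite_length V.
Proof. exact: finite_length_bounded strict_chain_bounded. Qed.

End FiniteLength.

(** * Coproducts *)

Section HomotopyCoproduct.
Variables (C : addcat) (J : choiceType).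

Lemma coproduct_ext (Y : J -> C) (S : C) (iota : forall j, hom (Y j) S) T
    (u u' : hom S T) : is_coproduct iota ->
  (forall j, u \oc iota j = u' \oc iota j) -> u = u'.
Proof.
move=> cop uu'; have [w [_ wu]] := cop T (fun j => u \oc iota j).
by rewrite -(wu u) // (wu u').
Qed.

(** Degreewise coproducts are coproducts up to homotopy, because a family of
homotopies can be assembled degreewise as well. *)
Lemma homotopy_coproduct (Y : J -> complex C) (S : complex C)
    (iota : forall j, chain_map (Y j) S) :
  (forall i, is_coproduct (fun j => iota j i)) ->
  @is_coproduct (homotopy_cat C) J Y S (fun j => kclass (iota j)).
Proof.
move=> cop T f.
have uP i : exists u : hom (S i) (T i), forall j, u \oc iota j i = krepr (f j) i.
  by have [u [uE _]] := cop i _ (fun j => krepr (f j) i); exists u.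
pose u i := sval (cid (uP i)).
have uE i j : u i \oc iota j i = krepr (f j) i by exact: (svalP (cid (uP i))).
have uC i i' : u i' \oc diff S i i' = diff T i i' \oc u i.
  apply: (coproduct_ext (cop i)) => j.
  by rewrite -!comp_assoc -chmP uE comp_assoc uE chmP.
pose U := ChainMap uC.
have UE j : kcomp (kclass U) (kclass (iota j)) = f j.
  rewrite kcompE -[RHS]kreprK; congr kclass.
  by apply: chain_map_ext => i; exact: uE.
exists (kclass U); split=> [j|u' u'E]; first exact: UE.
pose W := krepr (kclass U - u').
have W0 j : null_homotopic (chain_comp W (iota j)).
  apply: kclass_eq0P; rewrite -kcompE kreprK.
  suff : (kclass U - u' : hom (S : homotopy_cat C) (T : homotopy_cat C))
    \oc (kclass (iota j) : hom (Y j : homotopy_cat C) (S : homotopy_cat C)) = 0 by [].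
  rewrite comp_addl compNm u'E; apply/eqP; rewrite subr_eq0; apply/eqP.
  exact: UE.
pose h j := sval (cid (W0 j)).
have hE j i : W i \oc iota j i =
    diff T (i - 1) i \oc h j i (i - 1) + h j (i + 1) i \oc diff (Y j) i (i + 1).
  exact: (svalP (cid (W0 j))).
have HP i i' : exists H : hom (S i) (T i'), forall j, H \oc iota j i = h j i i'.
  by have [H [HE _]] := cop i _ (fun j => h j i i'); exists H.
pose H i i' := sval (cid (HP i i')).
have HE i i' j : H i i' \oc iota j i = h j i i' by exact: (svalP (cid (HP i i'))).
apply/eqP; rewrite -subr_eq0 -[_ - _]kreprK -/W; apply/eqP/kclass_eq0.
exists H => i; apply: (coproduct_ext (cop i)) => j.
by rewrite hE comp_addl -!comp_assoc HE -chmP comp_assoc HE.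
Qed.

End HomotopyCoproduct.

Section FiniteDimension.
Variable k : fieldType.
Implicit Types V W : lmodType k.

Definition finite_dim V := exists (d : finType) (e : d -> V)
  (phi : d -> {linear V -> k^o}), forall x, x = \sum_i phi i x *: e i.

Lemma finite_dim_rV d : finite_dim 'rV[k]_d.
Proof.
exists 'I_d, (fun i => delta_mx 0 i).
have phil i : linear (fun x : 'rV[k]_d => x 0 i : k^o) by move=> c x y; rewrite !mxE.
by exists (fun i => mk_linear (phil i)) => x; rewrite -row_sum_delta.
Qed.

Lemma finite_dim_prod V W : finite_dim V -> finite_dim W -> finite_dim (V * W)%type.
Proof.
move=> [d [e [phi eP]]] [d' [e' [phi' e'P]]].
exists (d + d')%type, (fun i => match i with inl j => (e j, 0) | inr j => (0, e' j) end).
have phil (i : d + d') : linear (fun x : V * W =>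
    match i with inl j => phi j x.1 | inr j => phi' j x.2 end).
  by move=> c x y; case: i => j; rewrite /= linearP.
exists (fun i => mk_linear (phil i)) => x; rewrite big_sumType /=.
have fst_sum (I : finType) (F : I -> (V * W)%type) : (\sum_i F i).1 = \sum_i (F i).1.
  exact: (big_morph fst).
have snd_sum (I : finType) (F : I -> (V * W)%type) : (\sum_i F i).2 = \sum_i (F i).2.
  exact: (big_morph snd).
rewrite [LHS]surjective_pairing [RHS]surjective_pairing; congr pair.
  rewrite /= !fst_sum [X in _ + X]big1 ?addr0; first exact: eP.
  by move=> i _; rewrite /= scaler0.
rewrite /= !snd_sum [X in X + _]big1 ?add0r; first exact: e'P.
by move=> i _; rewrite /= scaler0.
Qed.

(** For $V$ of finite dimension, $V^L = V \otimes k^L$ is the direct sum of copies of $V$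
indexed by a basis of $k^L$: products of copies of $V$ are also coproducts. *)
Variables (L : Type) (J : choiceType) (b : J -> (L -> k^o)).
Hypothesis basis_b : forall (W : lmodType k) (f : J -> W),
  (exists g : {linear (L -> k^o) -> W}, forall j, g (b j) = f j) /\
  (forall g g' : {linear (L -> k^o) -> W}, (forall j, g (b j) = g' (b j)) -> g =1 g').

Lemma power_linear_exists V W (g : J -> {linear V -> W}) : finite_dim V ->
  exists G : {linear (L -> V) -> W},
    forall j x, G (fun t => b j t *: x) = g j x.
Proof.
move=> [d [e [phi eP]]].
have HP i : exists H : {linear (L -> k^o) -> W}, forall j, H (b j) = g j (e i).
  exact: (basis_b (fun j => g j (e i))).1.
pose H i := sval (cid (HP i)).
have HE i j : H i (b j) = g j (e i) by exact: (svalP (cid (HP i))).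
have Gl : linear (fun x : L -> V => \sum_i H i (fun t => phi i (x t))).
  move=> c x y; rewrite scaler_sumr -big_split; apply: eq_bigr => i _ /=.
  by rewrite -linearP; congr (H i _); apply: funext => t; rewrite linearP.
exists (mk_linear Gl) => j x /=.
rewrite {2}[x]eP linear_sum; apply: eq_bigr => i _.
rewrite linearZ /= -HE -linearZ; congr (H i _); apply: funext => t.
by rewrite linearZ; exact: mulrC.
Qed.

Lemma power_linear_unique V W (G G' : {linear (L -> V) -> W}) : finite_dim V ->
  (forall j x, G (fun t => b j t *: x) = G' (fun t => b j t *: x)) -> G =1 G'.
Proof.
move=> [d [e [phi eP]]] GG' x.
have xE : x = \sum_i (fun t => phi i (x t) *: e i).
  by rewrite fct_sumE; apply: funext => t; exact: eP.
rewrite xE !linear_sum; apply: eq_bigr => i _.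
have el (F : {linear (L -> V) -> W}) : linear (fun c : L -> k^o => F (fun t => c t *: e i)).
  move=> a c c'; rewrite -linearP; congr (F _); apply: funext => t.
  by rewrite [LHS]scalerDl -[X in X + _ = _]scalerA.
apply: ((basis_b (fun=> 0)).2 (mk_linear (el G)) (mk_linear (el G')) _
  (fun t => phi i (x t))) => j.
exact: GG'.
Qed.

End FiniteDimension.

(** * Endofiniteness *)

Section Scalars.
Variables (k : fieldType) (n : nat).

Fact scale_linear (V : lmodType k) (c : k) : linear (fun x : V => c *: x).
Proof. by move=> a x y; rewrite scalerDr !scalerA mulrC. Qed.

Definition scal_hom (M : inj_cat k n) (c : k) : hom M M.
Proof.
apply: (mk_hom (f := fun v => mk_linear (@scale_linear (fiber M v) c))) => v x.
by rewrite /= linearZ.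
Defined.

Lemma ev_scal (M : inj_cat k n) c v (x : fiber M v) : ev (scal_hom M c) v x = c *: x.
Proof. by []. Qed.

Lemma scal_homC (M M' : inj_cat k n) (f : hom M M') c :
  f \oc scal_hom M c = scal_hom M' c \oc f.
Proof. by apply: hom_ext => v x; rewrite !ev_comp !ev_scal linearZ. Qed.

Variable X : complex (inj_cat k n).

Fact scal_chainP c i j :
  scal_hom (X j) c \oc diff X i j = diff X i j \oc scal_hom (X i) c.
Proof. by rewrite scal_homC. Qed.

Definition scal_chain c : chain_map X X := ChainMap (scal_chainP c).

Definition scal c : @hom (KInj k n) X X := kclass (scal_chain c).

Lemma scalD : {morph scal : a b / a + b}.
Proof.
move=> a b; rewrite /scal -kclassD; congr kclass; apply: chain_map_ext => i.
by apply: hom_ext => v x; rewrite chainDE evD !ev_scal scalerDl.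
Qed.

Lemma scalM a b : scal (a * b) = scal a \oc scal b.
Proof.
rewrite /scal /comp /= kcompE; congr kclass; apply: chain_map_ext => i.
by apply: hom_ext => v x; rewrite ev_comp !ev_scal scalerA.
Qed.

Lemma scal1 : scal 1 = idm (X : KInj k n).
Proof.
congr kclass; apply: chain_map_ext => i.
by apply: hom_ext => v x; rewrite ev_scal scale1r.
Qed.

End Scalars.

Lemma scalC (k : fieldType) (n : nat) (X Y : KInj k n) (f : hom X Y) c :
  f \oc scal X c = scal Y c \oc f.
Proof.
rewrite -[f]kreprK /scal /comp /= !kcompE; congr kclass; apply: chain_map_ext => i.
exact: scal_homC.
Qed.

Section Power.
Variables (k : fieldType) (n : nat) (L : Type).
Implicit Types (M N : inj_cat k n).

Definition power_rep (M : rep k n) : rep k n.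
Proof.
exists (fun v => (L -> M v) : lmodType k) (fun v x t => arrow M (x t)).
  by move=> v c x y; apply: funext => t; rewrite linearP.
by move=> v x; apply: funext => t; rewrite arrow_arrow.
Defined.

Definition rep_proj (M : rep k n) t : rep_hom (power_rep M) M :=
  @RepHom k n (power_rep M) M (fun v x => x t) (fun v c x y => erefl) (fun v x => erefl).

Definition rep_tuple (N M : rep k n) (f : L -> rep_hom N M) : rep_hom N (power_rep M).
Proof.
exists (fun v x t => rhom (f t) x).
  by move=> v c x y; apply: funext => t; rewrite linearP.
by move=> v x; apply: funext => t; rewrite rhom_arrow.
Defined.

Lemma power_injective (M : rep k n) : injective_rep M -> injective_rep (power_rep M).
Proof.
move=> Minj A B f g finj.
have hP t : exists h, rep_comp h f = rep_comp (rep_proj M t) g by exact: Minj.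
pose h t := sval (cid (hP t)).
exists (rep_tuple h); apply: rep_hom_ext => v x; apply: funext => t.
exact: (congr1 (fun u => rhom u x) (svalP (cid (hP t)))).
Qed.

Definition power M : inj_cat k n :=
  exist (@injective_rep k n) (power_rep (sval M)) (power_injective (svalP M)).

Definition proj M t : hom (power M) M := rep_proj (sval M) t.

Definition tuple_hom N M (f : L -> hom N M) : hom N (power M) := rep_tuple f.

Lemma proj_tuple N M (f : L -> hom N M) t : proj M t \oc tuple_hom f = f t.
Proof. by apply: hom_ext. Qed.

Lemma power_ext N M (f g : hom N (power M)) :
  (forall t, proj M t \oc f = proj M t \oc g) -> f = g.
Proof.
move=> fg; apply: hom_ext => v x; apply: funext => t.
exact: (congr1 (fun u => ev u v x) (fg t)).
Qed.

Lemma power_coproduct (J : choiceType) (b : J -> (L -> k^o)) M :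
  (forall (W : lmodType k) (f : J -> W),
    (exists g : {linear (L -> k^o) -> W}, forall j, g (b j) = f j) /\
    (forall g g' : {linear (L -> k^o) -> W}, (forall j, g (b j) = g' (b j)) -> g =1 g')) ->
  (forall v, finite_dim (fiber M v)) ->
  is_coproduct (fun j => tuple_hom (fun t => scal_hom M (b j t))).
Proof.
move=> basis_b fdM N f.
have GP v : exists G : {linear fiber (power M) v -> fiber N v},
    forall j x, G (fun t => b j t *: x) = ev (f j) v x.
  exact: (power_linear_exists basis_b (fun j => ev (f j) v) (fdM v)).
pose G v := sval (cid (GP v)).
have GE v j x : G v (fun t => b j t *: x) = ev (f j) v x by exact: (svalP (cid (GP v))).
have Ga v (x : fiber (power M) v) : G _ (arr x) = arr (G v x).
  pose G1 : {linear fiber (power M) v -> fiber N (ordS v)} := G _ \o @arr k n (power M) v.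
  pose G2 : {linear fiber (power M) v -> fiber N (ordS v)} := @arr k n N v \o G v.
  refine (@power_linear_unique k L J b basis_b (fiber M v) _ G1 G2 (fdM v) _ x) => j y.
  rewrite /= GE -ev_arr -GE; congr (G _ _).
  by apply: funext => t; rewrite -linearZ.
exists (mk_hom Ga); split=> [j|u uE].
  by apply: hom_ext => v x; exact: GE.
apply: hom_ext => v x.
pose U : {linear fiber (power M) v -> fiber N v} := ev u v.
refine (@power_linear_unique k L J b basis_b (fiber M v) _ (G v) U (fdM v) _ x) => j y.
by rewrite GE -uE.
Qed.

Variable X : complex (inj_cat k n).

Definition power_diff i j : hom (power (X i)) (power (X j)) :=
  tuple_hom (fun t => diff X i j \oc proj (X i) t).

Fact power_diff_degree i j : j != i + 1 -> power_diff i j = 0.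
Proof.
move=> ij; apply: power_ext => t.
by rewrite proj_tuple diff_degree // comp0m compm0.
Qed.

Fact power_diff_diff i j l : power_diff j l \oc power_diff i j = 0.
Proof.
apply: power_ext => t; rewrite comp_assoc proj_tuple -comp_assoc proj_tuple.
by rewrite comp_assoc diff_diff comp0m compm0.
Qed.

Definition power_complex : complex (inj_cat k n) :=
  Complex power_diff_degree power_diff_diff.

Fact proj_chainP t i j :
  proj (X j) t \oc diff power_complex i j = diff X i j \oc proj (X i) t.
Proof. exact: proj_tuple. Qed.

Definition proj_chain t : chain_map power_complex X := ChainMap (proj_chainP t).

Variables (Y : complex (inj_cat k n)) (f : L -> chain_map Y X).

Fact tuple_chainP i j : tuple_hom (fun t => f t j) \oc diff Y i j =
  diff power_complex i j \oc tuple_hom (fun t => f t i).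
Proof.
apply: power_ext => t; rewrite !comp_assoc proj_tuple.
by rewrite (proj_chainP t) -comp_assoc proj_tuple chmP.
Qed.

Definition tuple_chain : chain_map Y power_complex :=
  @ChainMap _ Y power_complex (fun i => tuple_hom (fun t => f t i)) tuple_chainP.

Lemma proj_tuple_chain t : chain_comp (proj_chain t) tuple_chain = f t.
Proof. by apply: chain_map_ext => i; exact: proj_tuple. Qed.

End Power.

Lemma comp_sumr (C : addcat) (X Y Z : C) (g : hom Y Z) (I : Type) (s : seq I)
    (F : I -> hom X Y) : g \oc (\sum_(i <- s) F i) = \sum_(i <- s) (g \oc F i).
Proof. by apply: (big_morph (comp g)) => [f f'|]; [exact: comp_addr | exact: compm0]. Qed.

(** Let $L = Hom(X, T)$. The tautological map from $X$ to the product $T^L$ has all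
elements of $L$ as its components. As $T^L$ is also the coproduct of copies of
$T$ over a basis $J$ of $k^L$, for compact $X$ the map factors through finitely many
copies; so each component is a linear combination of the same finite set of maps. *)
Theorem compact_finite_span (k : fieldType) (n : nat) (T : complex (inj_cat k n))
    (X : KInj k n) :
  (forall i v, finite_dim (fiber (T i) v)) -> compact X ->
  exists (d : nat) (g : 'I_d -> @hom (KInj k n) X T),
    forall f : @hom (KInj k n) X T, exists c : 'I_d -> k,
      f = \sum_i (scal T (c i) \oc g i).
Proof.
move=> fdT Xcompact; pose L : Type := @hom (KInj k n) X T.
have [J [b basis_b]] := basis_exists ((L -> k^o) : lmodType k).
pose iota j : chain_map T (power_complex L T) := tuple_chain (fun t => scal_chain T (b j t)).
pose u : chain_map X (power_complex L T) := tuple_chain (fun t : L => krepr t).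
pose TK : KInj k n := T; pose P : KInj k n := power_complex L T.
pose inK j : hom TK P := kclass (iota j).
pose projK t : hom P TK := kclass (proj_chain T t).
have cop : is_coproduct inK.
  by apply: homotopy_coproduct => i; exact: power_coproduct.
have [g [[_ uE] _]] := Xcompact _ _ _ _ cop (kclass u).
(* The sum over J is by definition a sum over its finite support. *)
have [s {}uE] : exists s : seq J, kclass u = \sum_(j <- s) (inK j \oc g j).
  by eexists; exact: uE.
exists (size s), (fun i => g (tnth (in_tuple s) i)) => f.
exists (fun i => b (tnth (in_tuple s) i) f).
have fE : projK f \oc (kclass u : hom X P) = f.
  by rewrite /comp /= kcompE proj_tuple_chain kreprK.
rewrite -[LHS]fE uE comp_sumr big_tnth; apply: eq_bigr => i _.
rewrite comp_assoc; congr (_ \oc _).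
by rewrite /comp /= kcompE proj_tuple_chain.
Qed.

(** The field acts on every morphism group through endomorphisms and commutes with all
maps, so that finite spanning sets are transported along isomorphisms. *)
Lemma endofinite_of_finite_dim (k : fieldType) (n : nat)
    (T : complex (inj_cat k n)) (E : KInj k n) :
  (forall i v, finite_dim (fiber (T i) v)) -> isomorphic E (T : KInj k n) ->
  endofinite E.
Proof.
move=> fdT [f [g [gf fg]]] X Xcompact.
have [d [h hE]] := compact_finite_span fdT Xcompact.
apply: (@finite_length_spanned k (endo E) (endo_hom X E)
  (fun c => scal E c) d (fun i => g \oc h i)).
- exact: scalD.
- exact: scalM.
- exact: scal1.
move=> x; have [c cE] := hE (f \oc x); exists c.
rewrite -[LHS]comp_idl -gf -comp_assoc cE comp_sumr; apply: eq_bigr => i _.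
by rewrite comp_assoc scalC -comp_assoc.
Qed.

Lemma finite_dim_string (k : fieldType) (n : nat) (n_gt0 : (0 < n)%N) l m p i v :
  finite_dim (fiber (string_cpx k n_gt0 l m p i) v).
Proof.
rewrite /string_cpx /=; case: (in_range l m (i + p)); last exact: finite_dim_rV.
by apply: finite_dim_prod; exact: finite_dim_rV.
Qed.

Theorem theorem1p1 (k : closedFieldType) (n : nat) (n_gt0 : (0 < n)%N) :
  (forall X : KInj k n,
      indecomposable X <->
      exists (l m : \bar int) (p : int),
        [/\ l != +oo%E, m != -oo%E, (l <= m)%E
          & isomorphic X
              (shift p (trunc l m (periodic_complex k n_gt0)) : KInj k n)]) /\
  (forall X : KInj k n, indecomposable X -> endofinite X).
Proof.
split=> X; last first.
  move=> /(indecomposable_string n_gt0)[l [m [p [_ XT]]]].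
  by apply: endofinite_of_finite_dim XT => i v; exact: finite_dim_string.
split=> [/(indecomposable_string n_gt0)[l [m [p [/in_range_exists[lo mo lm] XT]]]]|].
  by exists l, m, p.
move=> [l [m [p [lo mo lm XT]]]]; apply: (indecomposable_isomorphic XT).
by apply: string_indecomposable; apply/in_range_exists.
Qed.
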